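(* Let $n>k\ge1$ and let $F:(\mathbb{C}^n,0)\to(\mathbb{C}^k,0)$ be a strictly holomorphic-like (respectively, strictly anti-holomorphic-like) mixed ICIS. Then, for every sufficiently small $r>0$, the link $K_F=V_F\cap\mathbb{S}^{2n-1}_r$ of the variety $V_F=F^{-1}(0)$ is a positive (respectively, negative) contact submanifold of the sphere $\mathbb{S}_r^{2n-1}$ with its canonical contact structure.
   Context: A mixed map germ $F=(f^1,\dots,f^k):(\mathbb{C}^n,0)\to(\mathbb{C}^k,0)$ is the germ at $0$ of a real analytic map with $F(0)=0$. It is a mixed ICIS if $n>k$, $V_F=F^{-1}(0)$ has positive dimension and, near $0$, every point of $V_F\setminus\{0\}$ is a regular point of $F$ (real Jacobian of rank $2k$). Let $\rho(z)=\sum_i|z_i|^2$, so $\mathbb{S}^{2n-1}_r=\rho^{-1}(r^2)$, and, with $z_i=x_i+\sqrt{-1}\,y_i$, let $\alpha=2\sum_i(x_idy_i-y_idx_i)$. The canonical contact structure on $\mathbb{S}^{2n-1}_r$ is $\xi_r=\ker(\alpha|_{\mathbb{S}^{2n-1}_r})$. Write $f^j=f^j_1+\sqrt{-1}f^j_2$ (real and imaginary parts). The real function $\mathcal{D}^F(z,\bar z)$ is determined by $$d\rho\wedge\alpha\wedge(d\alpha)^{n-k-1}\wedge df^1_1\wedge df^1_2\wedge\cdots\wedge df^k_1\wedge df^k_2=(\sqrt{-1})^n2^{n-k-1}(n-k-1)!\;\mathcal{D}^F\;dz_1\wedge d\bar z_1\wedge\cdots\wedge dz_n\wedge d\bar z_n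 .$$ A mixed ICIS $F$ is strictly holomorphic-like (resp. strictly anti-holomorphic-like) if there is a neighbourhood $U$ of $0$ such that $\mathcal{D}^F>0$ (resp. $\mathcal{D}^F<0$) on $(V_F\setminus\{0\})\cap U$. Orient $K_F$ so that a volume form $\omega$ on $K_F$ is positive iff $d\rho\wedge\omega\wedge df^1_1\wedge df^1_2\wedge\cdots\wedge df^k_1\wedge df^k_2$ is positive for the complex orientation of $\mathbb{C}^n$ along $K_F$. $K_F$ is a positive (resp. negative) contact submanifold if $\alpha|_{K_F}\wedge(d\alpha|_{K_F})^{n-k-1}$ is everywhere a positive (resp. negative) volume form on $K_F$; in particular $\alpha|_{K_F}$ is a contact form. *)

(* Defs.v *)
From HB Require Import structures.
From mathcomp Require Import all_boot all_order all_algebra.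
From mathcomp Require Import finmap.
From mathcomp Require Import complex.
From mathcomp Require Import all_classical all_reals all_analysis.

Set Implicit Arguments.
Unset Strict Implicit.
Unset Printing Implicit Defensive.

Import Order.TTheory GRing.Theory Num.Theory.
Import numFieldNormedType.Exports.

Local Open Scope classical_set_scope.
Local Open Scope ring_scope.
Local Open Scope complex_scope.

(** * Pointwise exterior algebra

   A covector of degree [p] on [V] with values in [K] is a function on lists of
   vectors which vanishes on lists whose length is not [p]; the degree is thus
   not part of the type and degrees can be added without casts. *)

Definition ext_form (V : Type) (K : Type) := seq V -> K.

(* The number of pairs of positions [i < j] where [i] is not selected by the
   mask and [j] is: the length of the shuffle that moves the selected positions
   to the front. *)
Definition shuffle_length (p : nat) (m : p.-tuple bool) : nat :=
  \sum_(i < p) \sum_(j < p | (i < j)%N) (~~ tnth m i && tnth m j).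

(* (a /\ b)(v_1, ..., v_(p+q)) is the sum over all (p,q)-shuffles s of
   sgn(s) a(v_s(1), ..., v_s(p)) b(v_s(p+1), ..., v_s(p+q)), so that
   (l_1 /\ ... /\ l_p)(v_1, ..., v_p) = det (l_i v_j). *)
Definition wedge (V : Type) (K : comNzRingType) (a b : ext_form V K)
  : ext_form V K :=
  fun s => \sum_(m : (size s).-tuple bool)
    (-1) ^+ shuffle_length m * a (mask m s) * b (mask (map negb m) s).

Definition form_one (V : Type) (K : comNzRingType) : ext_form V K :=
  fun s => if s is [::] then 1 else 0.

Definition form1 (V : Type) (K : comNzRingType) (l : V -> K) : ext_form V K :=
  fun s => if s is [:: v] then l v else 0.

Definition form2 (V : Type) (K : comNzRingType) (b : V -> V -> K) : ext_form V K :=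
  fun s => if s is [:: u; v] then b u v else 0.

Definition wedge_power (V : Type) (K : comNzRingType) (a : ext_form V K)
    (m : nat) : ext_form V K := iter m (wedge a) (@form_one V K).

Definition alternating (K : comNzRingType) (V : lmodType K) (p : nat)
    (w : ext_form V K) : Prop :=
  [/\ forall s, size s != p -> w s = 0,
      forall s1 s2 a u v, w (s1 ++ (a *: u + v) :: s2) =
        a * w (s1 ++ u :: s2) + w (s1 ++ v :: s2)
    & forall s1 s2 s3 u, w (s1 ++ u :: s2 ++ u :: s3) = 0].

(** * Calculus on R^N *)

(* [d a (u, v) = u (a v) - v (a u)] for constant vector fields [u], [v]. *)
Definition ext_derivative (R : realType) (N : nat)
    (a : 'rV[R]_N -> 'rV[R]_N -> R) (p : 'rV[R]_N) : ext_form 'rV[R]_N R :=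
  form2 (fun u v => 'D_u (fun q => a q v : R^o) p - 'D_v (fun q => a q u : R^o) p).

(* Near [p], [F] is the sum of a power series in the real coordinates,
   unconditionally (equivalently absolutely) convergent. *)
Definition real_analytic_at (R : realType) (N m : nat)
    (F : 'rV[R]_N -> 'rV[R]_m) (p : 'rV[R]_N) : Prop :=
  exists c : {ffun 'I_N -> nat} -> 'rV[R]_m,
    \forall x \near p, forall e : R, 0 < e ->
      exists A : {fset {ffun 'I_N -> nat}}, forall B : {fset {ffun 'I_N -> nat}},
        (A `<=` B)%fset ->
        `| F x - \sum_(a <- B) (\prod_(i < N) (x - p) 0 i ^+ a i) *: c a | < e.

(* All iterated directional derivatives exist and are differentiable on U. *)
Definition smooth_on (R : realType) (N m : nat)
    (U : set 'rV[R]_N) (g : 'rV[R]_N -> 'rV[R]_m) : Prop :=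
  forall (vs : seq 'rV[R]_N) (x : 'rV[R]_N), U x ->
    differentiable (foldr (fun v h => 'D_v h) g vs) x.

Definition regular_point (R : realType) (N m : nat)
    (g : 'rV[R]_N -> 'rV[R]_m) (p : 'rV[R]_N) : Prop :=
  \rank ('J g p) = m.

(* Embedded [d]-dimensional submanifold without boundary of R^N: near each of
   its points it is the preimage of a regular value of a smooth map to
   R^(N - d). *)
Definition submanifold (R : realType) (N d : nat) (M : set 'rV[R]_N) : Prop :=
  forall p, M p -> exists (U : set 'rV[R]_N) (c : nat) (g : 'rV[R]_N -> 'rV[R]_c),
    [/\ open U /\ U p,
        (d + c = N)%N,
        smooth_on U g,
        forall x, U x -> (M x <-> g x = 0)
      & forall x, U x -> M x -> regular_point g x].

(* Velocities of curves. *)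
Definition tangent (R : realType) (N : nat) (M : set 'rV[R]_N) (p : 'rV[R]_N)
  : set 'rV[R]_N :=
  [set v | exists gamma : R -> 'rV[R]_N,
    [/\ gamma 0 = p, \forall t \near (0 : R), M (gamma t)
      & is_derive (0 : R) (1 : R) gamma v]].

(* The dimension of the germ of [M] at [p] is the largest [d] such that every
   neighbourhood of [p] contains a nonempty [d]-dimensional submanifold lying
   in [M]. *)
Definition germ_dim_ge (R : realType) (N : nat) (M : set 'rV[R]_N)
    (p : 'rV[R]_N) (d : nat) : Prop :=
  forall U, nbhs p U ->
    exists S : set 'rV[R]_N, [/\ S `<=` M `&` U, S !=set0 & submanifold d S].

(** * Complex coordinates

   C^n is R^(n + n), with z = x + i y written as the row (x, y). *)

Section ComplexCoordinates.
Context {R : realType} {n : nat}.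
Implicit Types (z v : 'rV[R]_(n + n)) (i : 'I_n).

Definition xcoord z i : R := z 0 (lshift n i).
Definition ycoord z i : R := z 0 (rshift n i).

Definition rho z : R := \sum_i (xcoord z i ^+ 2 + ycoord z i ^+ 2).

Definition sphere (r : R) : set 'rV[R]_(n + n) := [set z | rho z = r ^+ 2].

(* [alpha z v] is the value at the tangent vector [v] of the 1-form
   2 sum_i (x_i dy_i - y_i dx_i) at the point [z]. *)
Definition alpha z v : R :=
  2 * \sum_i (xcoord z i * ycoord v i - ycoord z i * xcoord v i).

Definition drho z : ext_form 'rV[R]_(n + n) R := form1 ('d (rho : _ -> R^o) z).

Definition dalpha z : ext_form 'rV[R]_(n + n) R := ext_derivative alpha z.

(* alpha /\ (d alpha)^m *)
Definition contact_volume (m : nat) z : ext_form 'rV[R]_(n + n) R :=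
  wedge (form1 (alpha z)) (wedge_power (dalpha z) m).

Definition dz i : ext_form 'rV[R]_(n + n) R[i] :=
  form1 (fun v => xcoord v i +i* ycoord v i).
Definition dzbar i : ext_form 'rV[R]_(n + n) R[i] :=
  form1 (fun v => xcoord v i -i* ycoord v i).

(* dz_1 /\ dzbar_1 /\ ... /\ dz_n /\ dzbar_n *)
Definition dz_dzbar : ext_form 'rV[R]_(n + n) R[i] :=
  \big[@wedge _ _/@form_one _ _]_(i < n) wedge (dz i) (dzbar i).

(* The real basis (e_1, i e_1, ..., e_n, i e_n) defining the complex
   orientation. *)
Definition complex_frame : seq 'rV[R]_(n + n) :=
  flatten [seq [:: delta_mx 0 (lshift n i); delta_mx 0 (rshift n i)]
          | i <- enum 'I_n].

Definition positive_complex_orientation (w : ext_form 'rV[R]_(n + n) R) : Prop :=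
  0 < w complex_frame.

End ComplexCoordinates.

(** * Mixed map germs *)

Section MixedGerms.
Context {R : realType} {n k : nat}.
Implicit Types (F : 'rV[R]_(n + n) -> 'rV[R]_(k + k)) (z : 'rV[R]_(n + n)).

Definition zero_set F : set 'rV[R]_(n + n) := [set z | F z = 0].

(* df^1_1 /\ df^1_2 /\ ... /\ df^k_1 /\ df^k_2 *)
Definition dF_wedge F z : ext_form 'rV[R]_(n + n) R :=
  \big[@wedge _ _/@form_one _ _]_(j < k)
    wedge (form1 ('d (fun q => xcoord (F q) j : R^o) z))
          (form1 ('d (fun q => ycoord (F q) j : R^o) z)).

Definition mixed_map_germ F : Prop :=
  F 0 = 0 /\ \forall z \near (0 : 'rV[R]_(n + n)), real_analytic_at F z.

Definition mixed_ICIS F : Prop :=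
  [/\ mixed_map_germ F,
      (k < n)%N,
      exists2 d, (0 < d)%N & germ_dim_ge (zero_set F) 0 d
    & \forall z \near (0 : 'rV[R]_(n + n)),
        zero_set F z -> z != 0 -> regular_point F z].

(* The equation determining the value [D] of D^F at [z]. *)
Definition DF_equation F z (D : R) : Prop :=
  forall s,
    (wedge (drho z) (wedge (contact_volume (n - k - 1) z) (dF_wedge F z)) s)%:C
    = 'i ^+ n * 2 ^+ (n - k - 1) * (n - k - 1)`!%:R * D%:C * dz_dzbar s.

(* For [k < n] the equation compares two forms of top degree and [dz_dzbar] is
   not zero, so that it has exactly one real solution and the default value 0 is never used. *)
Definition DF F z : R := xget 0 [set D | DF_equation F z D].

Definition strictly_holomorphic_like F : Prop :=
  mixed_ICIS F /\ \forall z \near (0 : 'rV[R]_(n + n)),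
    zero_set F z -> z != 0 -> 0 < DF F z.

Definition strictly_antiholomorphic_like F : Prop :=
  mixed_ICIS F /\ \forall z \near (0 : 'rV[R]_(n + n)),
    zero_set F z -> z != 0 -> DF F z < 0.

Definition link F (r : R) : set 'rV[R]_(n + n) := zero_set F `&` sphere r.

(* [w] is defined on the ambient space but only its restriction to the tangent
   space of the link matters: drho /\ w /\ dF has to be positive for every
   form [w'] of the ambient space with the same restriction. *)
Definition positive_on_link F (r : R) z (w : ext_form 'rV[R]_(n + n) R)
  : Prop :=
  forall w' : ext_form 'rV[R]_(n + n) R,
    alternating ((n - k).*2.-1) w' ->
    (forall s, (forall v, v \in s -> tangent (link F r) z v) -> w' s = w s) ->
    positive_complex_orientation (wedge (drho z) (wedge w' (dF_wedge F z))).

Definition negative_on_link F (r : R) z (w : ext_form 'rV[R]_(n + n) R)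
  : Prop :=
  positive_on_link F r z (fun s => - w s).

(* The link has real dimension 2(n - k) - 1. *)
Definition positive_contact_submanifold F (r : R) : Prop :=
  [/\ submanifold ((n - k).*2.-1) (link F r),
      link F r `<=` sphere r
    & forall z, link F r z ->
        positive_on_link F r z (contact_volume (n - k - 1) z)].

Definition negative_contact_submanifold F (r : R) : Prop :=
  [/\ submanifold ((n - k).*2.-1) (link F r),
      link F r `<=` sphere r
    & forall z, link F r z ->
        negative_on_link F r z (contact_volume (n - k - 1) z)].

End MixedGerms.

(* Main.v *)
Require Import Defs.
From HB Require Import structures.
From mathcomp Require Import all_boot all_order all_algebra.
From mathcomp Require Import finmap complex.
From mathcomp Require Import all_classical all_reals all_analysis.
From mathcomp Require Import ring lra zify.

Set Implicit Arguments.
Unset Strict Implicit.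
Unset Printing Implicit Defensive.

Import Order.TTheory GRing.Theory Num.Theory.
Import numFieldNormedType.Exports.
(* [alternating] is the predicate on [ext_form], not the one on bilinear forms *)
Import Defs.

(** Near a point [z] of the link, the link is the zero set of the real analytic
   map [G = (F, rho - r^2)] with values in [R^(2k+1)]. Let [T] be the top form
   [drho /\ alpha /\ (d alpha)^(n-k-1) /\ dF] at [z]. Its value on the complex frame
   is a positive multiple of [D^F] ([DF_frame]), because
   [dz_1 /\ dzbar_1 /\ ...] takes the value [(-2i)^n] there; so it is positive
   (negative) when [F] is strictly (anti-)holomorphic-like and [r] is small.

   Everything else is a matter of counting arguments. The kernel of [dG] is the
   common kernel of [drho] and of the [2k] components of [dF], and there is a
   basis of [R^(2n)] with only [rank dG] vectors outside this kernel
   ([adapted_basis]). An alternating form of top degree vanishing on a basis is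
   zero, so it is zero as soon as it needs more than [rank dG] arguments outside
   the kernel ([feeds_on_top0]).
   - [T] needs [2k+1] of them and is not zero, so [dG] has rank [2k+1] and the
     link is a submanifold of dimension [2(n-k)-1] ([link_map_regular]).
   - If [w] and [c alpha /\ (d alpha)^(n-k-1)] agree on the tangent vectors of
     the link, their difference [eta] vanishes on the kernel, so
     [drho /\ eta /\ dF] needs [2k+2] such arguments and is zero: hence
     [drho /\ w /\ dF = c T] ([top_form_tangent]). This uses that every vector of
     the kernel is the velocity of a curve in the link ([kernel_velocity]), which
     is obtained by correcting a straight line with a contraction.

   The two analytic inputs, that [G] is smooth and that it is strictly
   differentiable, come from termwise differentiation of power series in several
   variables with a quadratic remainder that is uniform near the centre
   ([analytic_expansion]); a partial derivative is again given by a power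
   series, so the argument can be iterated. *)

Local Open Scope classical_set_scope.
Local Open Scope ring_scope.

(** * The wedge product *)

(** Putting an unselected position in front adds one inversion for each
   selected position. *)
Lemma shuffle_length_cons p (c : bool) (m : p.-tuple bool) :
  shuffle_length [tuple of c :: m] =
  ((if c then 0 else count id m) + shuffle_length m)%N.
Proof.
rewrite /shuffle_length big_ord_recl; congr (_ + _)%N.
  rewrite big_mkcond big_ord_recl /= add0n.
  under eq_bigr => j _ do rewrite !tnthS tnth0.
  case: c => /=; first by rewrite big1.
  rewrite -sum1_count big_tuple /= [RHS]big_mkcond /=.
  by apply: eq_bigr => j _; case: (tnth m j).
apply: eq_bigr => i _; rewrite big_mkcond big_ord_recl /= add0n -big_mkcond /=.
by apply: eq_bigr => j _; rewrite !tnthS.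
Qed.

Section Wedge.
Context {V : Type} {K : comNzRingType}.
Implicit Types (a b c : ext_form V K) (s t : seq V) (x : V).

(** The interior product [i_x a]. *)
Definition inner x a : ext_form V K := fun t => a (x :: t).
(** The form [(-1) ^ deg a * a], the degree being read off the arguments. *)
Definition twist a : ext_form V K := fun t => (-1) ^+ size t * a t.

Lemma wedge_nil a b : wedge a b [::] = a [::] * b [::].
Proof.
rewrite /wedge /= (big_pred1 [tuple]) ?mask0s.
  by rewrite /shuffle_length big_ord0 mul1r.
by move=> m; rewrite (tuple0 m) /= eqxx.
Qed.

(** The Leibniz rule [i_x (a /\ b) = i_x a /\ b + twist a /\ i_x b]; together
   with [wedge_nil] it is a recursive description of the wedge product. *)
Lemma wedge_cons a b x s :
  wedge a b (x :: s) = wedge (inner x a) b s + wedge (twist a) (inner x b) s.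
Proof.
rewrite {1}/wedge /=.
rewrite (reindex (fun q : bool * (size s).-tuple bool => [tuple of q.1 :: q.2])) /=.
  rewrite -(pair_bigA _ (fun q (m : (size s).-tuple bool) =>
     (-1) ^+ shuffle_length [tuple of q :: m] *
     a (mask (q :: m) (x :: s)) * b (mask (map negb (q :: m)) (x :: s)))) /=.
  rewrite big_bool /=; congr (_ + _); rewrite /wedge; apply: eq_bigr => m _.
    by rewrite shuffle_length_cons.
  rewrite shuffle_length_cons /twist /inner /= size_mask ?size_tuple //.
  by rewrite exprD; ring.
exists (fun m : (size s).+1.-tuple bool => (thead m, [tuple of behead m])).
  by move=> [q m] _ /=; congr pair; apply: val_inj.
by move=> m _ /=; rewrite [RHS]tuple_eta.
Qed.

Lemma eq_wedge a a' b b' : a =1 a' -> b =1 b' -> wedge a b =1 wedge a' b'.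
Proof. by move=> ea eb s; apply: eq_bigr => m _; rewrite ea eb. Qed.

Lemma wedgeDl a a' b s :
  wedge (fun t => a t + a' t) b s = wedge a b s + wedge a' b s.
Proof. by rewrite -big_split; apply: eq_bigr => m _ /=; ring. Qed.

Lemma wedgeDr a b b' s :
  wedge a (fun t => b t + b' t) s = wedge a b s + wedge a b' s.
Proof. by rewrite -big_split; apply: eq_bigr => m _ /=; ring. Qed.

Lemma wedgeZl k a b s : wedge (fun t => k * a t) b s = k * wedge a b s.
Proof. by rewrite big_distrr; apply: eq_bigr => m _ /=; ring. Qed.

Lemma wedgeZr k a b s : wedge a (fun t => k * b t) s = k * wedge a b s.
Proof. by rewrite big_distrr; apply: eq_bigr => m _ /=; ring. Qed.

Lemma wedgeNl a b s : wedge (fun t => - a t) b s = - wedge a b s.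
Proof. by rewrite -sumrN; apply: eq_bigr => m _ /=; ring. Qed.

End Wedge.

(** * Alternating forms *)

Section Alternating.
Context {K : comNzRingType} {V : lmodType K}.
Implicit Types (a b : ext_form V K) (s t : seq V).

(** The three parts of being alternating of degree [p]: linearity in each
   argument, vanishing on two equal neighbouring arguments, and vanishing on
   lists of the wrong size. Equal neighbours suffice, see [alternatingP], and
   they are what an induction along the list of arguments can follow. *)
Definition multilin a := forall s1 s2 k u v,
  a (s1 ++ (k *: u + v) :: s2) = k * a (s1 ++ u :: s2) + a (s1 ++ v :: s2).
Definition adj_alt a := forall s1 s2 u, a (s1 ++ u :: u :: s2) = 0.
Definition homog p a := forall s, size s != p -> a s = 0.

Lemma multilin_inner x a : multilin a -> multilin (inner x a).
Proof. by move=> h s1 s2 k u v; rewrite /inner (h (x :: s1)). Qed.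

Lemma multilin_twist a : multilin a -> multilin (twist a).
Proof.
by move=> h s1 s2 k u v; rewrite /twist h !size_cat /=; ring.
Qed.

Lemma adj_alt_inner x a : adj_alt a -> adj_alt (inner x a).
Proof. by move=> h s1 s2 u; rewrite /inner (h (x :: s1)). Qed.

Lemma adj_alt_twist a : adj_alt a -> adj_alt (twist a).
Proof. by move=> h s1 s2 u; rewrite /twist h mulr0. Qed.

Lemma multilin_wedge a b : multilin a -> multilin b -> multilin (wedge a b).
Proof.
move=> ha hb s1; elim: s1 a b ha hb => [|x s1 IH] a b ha hb s2 k u v /=.
  rewrite !wedge_cons.
  have -> : wedge (inner (k *: u + v) a) b s2 =
      k * wedge (inner u a) b s2 + wedge (inner v a) b s2.
    rewrite -wedgeZl -wedgeDl; apply: eq_wedge => // t.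
    by rewrite /inner (ha [::]).
  have -> : wedge (twist a) (inner (k *: u + v) b) s2 =
      k * wedge (twist a) (inner u b) s2 + wedge (twist a) (inner v b) s2.
    rewrite -wedgeZr -wedgeDr; apply: eq_wedge => // t.
    by rewrite /inner (hb [::]).
  ring.
rewrite !wedge_cons !IH //; try (by apply: multilin_inner);
  try (by apply: multilin_twist).
ring.
Qed.

Lemma adj_alt_wedge a b :
  adj_alt a -> adj_alt b -> adj_alt (wedge a b).
Proof.
move=> ha hb s1; elim: s1 a b ha hb => [|x s1 IH] a b ha hb s2 u /=.
  rewrite !wedge_cons.
  have wz a' b' : (forall t, a' t = 0) \/ (forall t, b' t = 0) ->
      wedge a' b' s2 = 0.
    by case=> h; rewrite /wedge big1 // => m _; rewrite h; ring.
  rewrite [X in X + _ + _]wz; last by left => t; rewrite /inner (ha [::]).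
  rewrite [X in _ + (_ + X)]wz; last by right => t; rewrite /inner (hb [::]).
  rewrite add0r addr0.
  (* the two surviving terms, [u] fed first to [a] then to [b] or conversely,
     have opposite signs *)
  have -> : wedge (twist (inner u a)) (inner u b) s2 =
            - wedge (inner u (twist a)) (inner u b) s2.
    rewrite -wedgeNl; apply: eq_wedge => // t; rewrite /inner /twist /= exprS.
    ring.
  by rewrite addNr.
rewrite wedge_cons !IH ?addr0 //; try (by apply: adj_alt_inner);
  by apply: adj_alt_twist.
Qed.

Lemma homog_wedge p q a b :
  homog p a -> homog q b -> homog (p + q) (wedge a b).
Proof.
move=> ha hb s hs; rewrite /wedge big1 // => m _.
have es : (size (mask m s) + size (mask (map negb m) s))%N = size s.
  rewrite !size_mask ?size_map ?size_tuple // count_map.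
  by rewrite count_predC size_tuple.
have [e|ne] := eqVneq (size (mask m s)) p; last by rewrite ha // mulr0 mul0r.
have [e'|ne'] := eqVneq (size (mask (map negb m) s)) q.
  by case/eqP: hs; rewrite -es e e'.
by rewrite hb // mulr0.
Qed.

Lemma adj_alt_swap a s1 s2 u v : multilin a -> adj_alt a ->
  a (s1 ++ u :: v :: s2) = - a (s1 ++ v :: u :: s2).
Proof.
move=> ml al.
have := al s1 s2 (1 *: u + v); rewrite (ml s1).
have e w : a (s1 ++ w :: (1 *: u + v) :: s2) =
   a (s1 ++ w :: u :: s2) + a (s1 ++ w :: v :: s2).
  by rewrite -!(cat_rcons w s1) ml mul1r.
rewrite mul1r !e !al add0r addr0 => /eqP.
by rewrite addr_eq0 => /eqP.
Qed.

(** Moving an argument to the front only changes the sign. *)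
Lemma adj_alt_front a s1 s2 u : multilin a -> adj_alt a ->
  a (s1 ++ u :: s2) = (-1) ^+ size s1 * a (u :: s1 ++ s2).
Proof.
elim: s1 a => [|x s1 IH] a ml al /=; first by rewrite mul1r.
have := IH (inner x a) (multilin_inner x ml) (adj_alt_inner x al).
rewrite /inner => ->.
by rewrite (@adj_alt_swap a [::]) // exprS; ring.
Qed.

Lemma alternatingP p a :
  alternating p a <-> [/\ homog p a, multilin a & adj_alt a].
Proof.
split=> [[h1 h2 h3]|[h1 h2 h3]]; split=> //.
  by move=> s1 s2 u; rewrite (h3 s1 [::]).
move=> s1 s2 s3 u; rewrite adj_alt_front // catA.
have h3u := adj_alt_inner u h3; have h2u := multilin_inner u h2.
have := adj_alt_front (s1 ++ s2) s3 u h2u h3u.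
rewrite -catA /inner => ->.
by rewrite (h3 [::]) !mulr0.
Qed.

Lemma alternating_wedge p q a b :
  alternating p a -> alternating q b -> alternating (p + q) (wedge a b).
Proof.
move=> /alternatingP[? ? ?] /alternatingP[? ? ?]; apply/alternatingP.
by split; [exact: homog_wedge|exact: multilin_wedge|exact: adj_alt_wedge].
Qed.

Lemma alternating_one : alternating 0 (@form_one V K).
Proof.
split=> [[]//|s1 s2 k u v|s1 s2 s3 u]; case: s1 => [|? ?] /=; rewrite ?mulr0 ?addr0 //.
Qed.

Lemma alternating_form1 (l : V -> K) :
  (forall k u v, l (k *: u + v) = k * l u + l v) -> alternating 1 (form1 l).
Proof.
move=> h; split=> [[|? [|? ?]]//|s1 s2 k u v|s1 s2 s3 u].
  case: s1 => [|? [|? ?]] /=; last by rewrite mulr0 addr0.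
    by case: s2 => [|? ?]; rewrite /= ?h // mulr0 addr0.
  by rewrite mulr0 addr0.
by case: s1 => [|? [|? ?]] //=; case: s2.
Qed.

Lemma alternating_form2 (c : V -> V -> K) :
  (forall u, c u u = 0) ->
  (forall k u v w, c (k *: u + v) w = k * c u w + c v w) ->
  (forall k u v w, c w (k *: u + v) = k * c w u + c w v) ->
  alternating 2 (form2 c).
Proof.
move=> h0 hl hr; apply/alternatingP.
split=> [[|? [|? [|? ?]]]//|s1 s2 k u v|s1 s2 u].
  case: s1 => [|x [|y [|? ?]]] /=; rewrite ?mulr0 ?addr0 //.
    by case: s2 => [|? [|? ?]] /=; rewrite ?mulr0 ?addr0.
  by case: s2 => [|? [|? ?]] /=; rewrite ?mulr0 ?addr0.
case: s1 => [|x [|y [|? ?]]] //=; first by case: s2 => [|? ?] /=.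
Qed.

Lemma alternating_wedge_power p a m :
  alternating p a -> alternating (m * p) (wedge_power a m).
Proof.
move=> h; elim: m => [|m IH]; first exact: alternating_one.
by rewrite mulSn; apply: alternating_wedge.
Qed.

Lemma alternating_big_wedge (I : Type) (r : seq I) p (f : I -> ext_form V K) :
  (forall i, alternating p (f i)) ->
  alternating (size r * p) (\big[@wedge _ _/@form_one _ _]_(i <- r) f i).
Proof.
move=> h; elim: r => [|i r IH]; first by rewrite big_nil; exact: alternating_one.
by rewrite big_cons mulSn; apply: alternating_wedge.
Qed.

Lemma alternating_lin p a b k : alternating p a -> alternating p b ->
  alternating p (fun s => a s + k * b s).
Proof.
move=> [a1 a2 a3] [b1 b2 b3]; split=> [s hs|s1 s2 l u v|s1 s2 s3 u].
- by rewrite a1 // b1 // mulr0 addr0.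
- by rewrite a2 b2; ring.
- by rewrite a3 b3 mulr0 addr0.
Qed.

Lemma alternating_perm0 p a s t :
  alternating p a -> perm_eq s t -> a s = 0 -> a t = 0.
Proof.
move=> /alternatingP[_].
elim: t s a => [|x t IH] s a ml al.
  by move=> /perm_size /size0nil ->.
move=> pst; have xs : x \in s by rewrite (perm_mem pst) mem_head.
case/splitPr: xs pst => s1 s2 pst.
rewrite adj_alt_front // => h.
apply: (IH (s1 ++ s2) (inner x a)).
- exact: multilin_inner.
- exact: adj_alt_inner.
- by rewrite -(perm_cons x) -(permPr pst) -[x :: s2]cat1s -cat1s perm_catCA perm_refl.
- by rewrite /inner; move: h => /(congr1 ( *%R ((-1) ^+ size s1)));
    rewrite mulrA -expr2 sqrr_sign mul1r mulr0.
Qed.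

(** An alternating form whose degree is the size of a spanning list, and which
   vanishes on that list, is zero. *)
Lemma alternating_span0 p a s :
  alternating p a -> size s = p -> uniq s ->
  (forall v, exists c : V -> K, v = \sum_(x <- s) c x *: x) ->
  a s = 0 -> forall t, a t = 0.
Proof.
move=> alt ss us span as0.
have [ha ml _] := alt.
(* on elements of [s]: either two coincide or they are a permutation of [s] *)
have basis t : {subset t <= s} -> a t = 0.
  move=> ts; have [e|ne] := eqVneq (size t) p; last exact: ha.
  have [ut|] := boolP (uniq t).
    apply: (alternating_perm0 alt _ as0); apply: uniq_perm => //.
    move=> x; have [] := uniq_min_size ut ts; first by rewrite ss e.
    by move=> _ /(_ x) ->.
  have [_ _ hr] := alt.
  move=> /(uniqPn 0)[i [j [ij jt eij]]].
  have it := ltn_trans ij jt.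
  rewrite -(cat_take_drop j t) (drop_nth 0) //.
  have itk : (i < size (take j t))%N by rewrite size_take jt.
  rewrite -(cat_take_drop i (take j t)) (drop_nth 0 itk).
  by rewrite nth_take // eij -catA /= hr.
(* expand the arguments one after the other along [s] *)
move=> t; suff: forall t1 t2, {subset t1 <= s} -> a (t1 ++ t2) = 0.
  by move=> /(_ [::] t); apply.
move=> {}t1 t2; elim: t2 t1 => [|v t2 IH] t1 st1.
  by rewrite cats0; apply: basis.
have [c ->] := span v.
have z : forall r, {subset r <= s} -> a (t1 ++ (\sum_(x <- r) c x *: x) :: t2) = 0.
  elim=> [|x r IHr] rs.
    rewrite big_nil; have := ml t1 t2 (-1) 0 0.
    by rewrite scaler0 addr0 mulN1r addNr.
  rewrite big_cons ml IHr ?addr0; last by move=> y yr; apply: rs; rewrite inE yr orbT.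
  rewrite -cat_rcons IH ?mulr0 // => y; rewrite mem_rcons inE => /orP[/eqP ->|/st1 //].
  by apply: rs; rewrite mem_head.
exact: z.
Qed.

End Alternating.

(** * Vanishing by counting arguments *)

Lemma count_mask_negb (T : Type) (Q : pred T) (m : bitseq) (s : seq T) :
  size m = size s ->
  (count Q (mask m s) + count Q (mask (map negb m) s) = count Q s)%N.
Proof.
elim: s m => [|x s IH] [|[] m] //= [] /IH <-; first by rewrite addnA.
by rewrite addnCA.
Qed.

Section Level.
Context {V : Type} {K : comNzRingType}.
Implicit Types (a b : ext_form V K) (Q : pred V).

(** [a] vanishes as soon as fewer than [p] of its arguments satisfy [Q]. *)
Definition feeds_on Q p a := forall s, (count Q s < p)%N -> a s = 0.

Lemma feeds_on_wedge Q p q a b :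
  feeds_on Q p a -> feeds_on Q q b -> feeds_on Q (p + q) (wedge a b).
Proof.
move=> ha hb s hs; rewrite /wedge big1 // => m _.
have e := @count_mask_negb _ Q m s (size_tuple m).
have [lt|ge] := ltnP (count Q (mask m s)) p; first by rewrite ha // mulr0 mul0r.
rewrite hb ?mulr0 // ltnNge; apply: contraTN hs => qB.
by rewrite -leqNgt -e leq_add.
Qed.

Lemma feeds_on_form1 Q (l : V -> K) :
  (forall v, ~~ Q v -> l v = 0) -> feeds_on Q 1 (form1 l).
Proof.
move=> h [|v [|? ?]] //= hs; apply: h; apply/negP => Qv; move: hs; by rewrite Qv.
Qed.

Lemma feeds_on0 Q a : feeds_on Q 0 a.
Proof. by []. Qed.

Lemma feeds_on_big (I : Type) (r : seq I) Q p (f : I -> ext_form V K) :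
  (forall i, feeds_on Q p (f i)) ->
  feeds_on Q (size r * p) (\big[@wedge _ _/@form_one _ _]_(i <- r) f i).
Proof.
move=> h; elim: r => [|i r IH]; first by rewrite big_nil; exact: feeds_on0.
by rewrite big_cons mulSn; apply: feeds_on_wedge.
Qed.
End Level.

(** A basis of row vectors of which at most [\rank J] are not killed by [J]. *)
Lemma adapted_basis (K : fieldType) (N c : nat) (J : 'M[K]_(N, c)) :
  exists s : seq 'rV[K]_N,
    [/\ size s = N, uniq s,
        forall v, exists d : 'rV[K]_N -> K, v = \sum_(x <- s) d x *: x
      & (count (fun v => v *m J != 0%R) s <= \rank J)%N].
Proof.
(* Gaussian elimination writes [J = E *m pid_mx (\rank J) *m U] with [E] and [U]
   invertible: the basis consists of the rows of the inverse of [E]. *)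
set E := col_ebase J; have uE : E \in unitmx := col_ebase_unit J.
pose B := invmx E.
have rE i : row i B *m E = row i 1%:M by rewrite -row_mul mulVmx.
exists [seq row i B | i <- enum 'I_N]; split.
- by rewrite size_map size_enum_ord.
- rewrite map_inj_uniq ?enum_uniq // => i j /(congr1 (mulmx^~ E)).
  rewrite !rE => /rowP /(_ i); rewrite !mxE eqxx.
  by case: eqP => [->//|_ /eqP]; rewrite oner_eq0.
- (* if [x] is row [i] of [B] then [x *m E] is the [i]-th unit vector, so the
     coefficient is the [i]-th coordinate of [v *m E] *)
  move=> v; exists (fun x => ((v *m E) *m (x *m E)^T) 0 0).
  rewrite big_map big_enum /=.
  rewrite -[LHS]mulmx1 -(mulmxV uE) mulmxA -/B mulmx_sum_row.
  apply: eq_bigr => i _; congr (_ *: _).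
  by rewrite rE row1 trmx_delta -colE [RHS]mxE.
- rewrite count_map -size_filter.
  have sub : {subset [seq nat_of_ord i | i <- enum 'I_N & row i B *m J != 0] <=
                  iota 0 (\rank J)}.
    move=> x /mapP[i im ->]; move: im.
    rewrite mem_filter mem_iota add0n => /andP[h _] /=.
    rewrite ltnNge; apply: contra h => ri; apply/eqP.
    have BJ : B *m J = pid_mx (\rank J) *m row_ebase J.
      by rewrite -{1}[J]mulmx_ebase -mulmxA mulKmx.
    rewrite -row_mul BJ row_mul.
    have -> : row i (pid_mx (\rank J) : 'M[K]_(N, c)) = 0.
      by apply/rowP => j; rewrite !mxE ltnNge ri andbF.
    by rewrite mul0mx.
  have := uniq_leq_size _ sub; rewrite size_map size_iota; apply.
  by rewrite map_inj_uniq; [exact/filter_uniq/enum_uniq|exact: val_inj].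
Qed.

(** An alternating form of top degree which needs more arguments outside the
   kernel of [J] than a basis can provide is zero. *)
Lemma feeds_on_top0 (K : fieldType) (N c : nat) (J : 'M[K]_(N, c))
    (a : ext_form 'rV[K]_N K) p :
  alternating N a -> feeds_on (fun v => v *m J != 0) p a ->
  (\rank J < p)%N -> forall t, a t = 0.
Proof.
move=> alt fa rp; have [s [ss us span cs]] := adapted_basis J.
by apply: (alternating_span0 alt ss us span); apply: fa; apply: leq_ltn_trans rp.
Qed.

(** * The value of the complex volume form on the complex frame *)

Lemma wedge_left0 (K : comNzRingType) (T : eqType) (a b : ext_form T K) s :
  (forall t, {subset t <= s} -> a t = 0) -> wedge a b s = 0.
Proof.
move=> h; rewrite /wedge big1 // => m _; rewrite h ?mulr0 ?mul0r //.
by move=> x; apply: mem_mask.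
Qed.

(** On the arguments [e :: f :: s], a decomposable 2-form whose factors vanish on
   [s] has to take both [e] and [f]. *)
Lemma wedge_form2_frame (K : comNzRingType) (T : eqType) (l l' : T -> K)
    (b : ext_form T K) (e f : T) s :
  (forall x, x \in s -> l x = 0) -> (forall x, x \in s -> l' x = 0) ->
  wedge (wedge (form1 l) (form1 l')) b (e :: f :: s) =
  (l e * l' f - l f * l' e) * b s.
Proof.
move=> hl hl'; set w := wedge (form1 l) (form1 l').
have w0 t : size t != 2%N -> w t = 0.
  move=> ht; rewrite /w /wedge big1 // => m _.
  have := @count_mask_negb _ predT m t (size_tuple m); rewrite !count_predT.
  case: (mask m t) => [|? [|? ?]]; rewrite /= ?mulr0 ?mul0r //.
  by case: (mask (map negb m) t) => [|? [|? ?]]; rewrite /= ?mulr0 // => e2;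
    rewrite -e2 in ht.
have w2 x y : w [:: x; y] = l x * l' y - l y * l' x.
  rewrite /w !wedge_cons !wedge_nil /inner /twist /=; ring.
have wx x y : y \in s -> w [:: x; y] = 0 by move=> ys; rewrite w2 (hl y) ?(hl' y) //; ring.
rewrite !wedge_cons.
have -> : wedge (inner f (inner e w)) b s = w [:: e; f] * b s.
  rewrite -[b s]mul1r; transitivity (wedge (fun t => w [:: e; f] * form_one K t) b s).
    apply: eq_wedge => // -[|x t]; rewrite /inner /= ?mulr1 // mulr0 w0 //.
  rewrite wedgeZl; congr (_ * _).
  elim: {w0 w2 wx hl hl'} s b => [|x s IH] b; first by rewrite wedge_nil.
  rewrite wedge_cons [X in X + _](_ : _ = 0) ?add0r; last first.
    by apply: wedge_left0 => t _.
  have := IH (inner x b); rewrite !mul1r => {}IH.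
  rewrite -[RHS]IH; apply: eq_wedge => // -[|y t]; rewrite /twist /= ?mulr1 ?mulr0 //.
rewrite !wedge_left0 ?addr0 ?w2 // => t ts; rewrite /twist /inner /=;
  case: t ts => [|x [|y [|? ?]]] ts;
  first [by rewrite w0 // ?mulr0 | by rewrite wx ?mulr0 // ts // !inE eqxx ?orbT].
Qed.

Section Frame.
Local Open Scope complex_scope.
Context {R : realType} {n : nat}.

Lemma dz_dzbar_frame :
  @dz_dzbar R n complex_frame = (- (2 * 'i)) ^+ n :> R[i].
Proof.
have ie : index_enum (ordinal n) = enum (ordinal n) by rewrite enumT /index_enum; unlock.
rewrite /dz_dzbar /complex_frame ie.
rewrite -[X in _ ^+ X](size_enum_ord n).
have := enum_uniq 'I_n; elim: (enum _) => [|i r IH] /=; first by rewrite big_nil.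
move=> /andP[ir ur]; rewrite big_cons wedge_form2_frame /=.
- rewrite (IH ur) exprS; congr (_ * _).
  rewrite /xcoord /ycoord !mxE !eqxx /=.
  rewrite !eq_lrshift !eq_rlshift /=.
  by apply/eqP; rewrite eq_complex /=; apply/andP; split; apply/eqP; ring.
- move=> x /flattenP[y /mapP[j jr ->]]; rewrite !inE.
  have ji : (j == i) = false by apply/eqP => e; rewrite -e jr in ir.
  by move=> /orP[]/eqP->; rewrite /xcoord /ycoord !mxE ?eq_lshift ?eq_rshift
    ?eq_lrshift ?eq_rlshift /= ?(eq_sym i) ?ji /=.
- move=> x /flattenP[y /mapP[j jr ->]]; rewrite !inE.
  have ji : (j == i) = false by apply/eqP => e; rewrite -e jr in ir.
  by move=> /orP[]/eqP->; rewrite /xcoord /ycoord !mxE ?eq_lshift ?eq_rshift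
    ?eq_lrshift ?eq_rlshift /= ?(eq_sym i) ?ji /= ?oppr0.
Qed.
End Frame.

(** * Unconditional sums *)

Section HasSum.
Context {R : realType} {I : choiceType} {W : normedModType R}.
Implicit Types (f g : I -> W) (l : W) (A B : {fset I}).

(** The finite partial sums of [f] converge to [l] along the directed set of
   finite sets of indices. *)
Definition has_sum f l := forall e : R, 0 < e ->
  exists A, forall B, (A `<=` B)%fset -> `|l - \sum_(a <- B) f a| < e.

Lemma has_sumD f g l k :
  has_sum f l -> has_sum g k -> has_sum (fun a => f a + g a) (l + k).
Proof.
move=> h h' e e0.
have e2 : 0 < e / 2 by rewrite divr_gt0.
have [A hA] := h _ e2; have [A' hA'] := h' _ e2.
exists (A `|` A')%fset => B; rewrite fsubUset => /andP[AB A'B].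
rewrite big_split /= opprD addrACA (le_lt_trans (ler_normD _ _)) //.
by rewrite [ltRHS](splitr e) ltrD // ?hA ?hA'.
Qed.

Lemma eq_has_sum f g l : f =1 g -> has_sum f l -> has_sum g l.
Proof.
move=> fg h e /h[A hA]; exists A => B /hA.
by under eq_bigr do rewrite fg.
Qed.

Lemma has_sum0 : has_sum (fun=> 0) 0.
Proof. by move=> e e0; exists fset0 => B _; rewrite big1 // subr0 normr0. Qed.

Lemma has_sum_sum (J : Type) (r : seq J) (f : J -> I -> W) (l : J -> W) :
  (forall j, has_sum (f j) (l j)) ->
  has_sum (fun a => \sum_(j <- r) f j a) (\sum_(j <- r) l j).
Proof.
move=> h; elim: r => [|j r IH].
  by rewrite big_nil; apply: (eq_has_sum _ has_sum0) => a; rewrite big_nil.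
rewrite big_cons; apply: (eq_has_sum _ (has_sumD (h j) IH)) => a.
by rewrite big_cons.
Qed.

Lemma has_sum_norm_le f l (g : I -> R) M :
  has_sum f l -> (forall a, `|f a| <= g a) ->
  (forall B : {fset I}, \sum_(a <- B) g a <= M) -> `|l| <= M.
Proof.
move=> h fg gM; apply/ler_addgt0Pr => e e0.
have [A /(_ A (fsubset_refl _)) hA] := h _ e0.
rewrite -[l](subrK (\sum_(a <- A) f a)) (le_trans (ler_normD _ _)) //.
rewrite addrC lerD ?(ltW hA) // (le_trans (ler_norm_sum _ _ _)) //.
by apply: le_trans (gM A); apply: ler_sum.
Qed.

(** The terms of a convergent family are bounded: outside the finite set which
   approximates the sum up to 1, each is the difference of two partial sums
   close to the sum. *)
Lemma has_sum_term_bounded f l : has_sum f l -> exists M : R, forall a, `|f a| <= M.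
Proof.
move=> /(_ 1 ltr01)[A hA]; exists (2 + \sum_(a <- A) `|f a|) => a.
have S0 (s : seq I) : 0 <= \sum_(a <- s) `|f a| by apply: sumr_ge0.
have [aA|aA] := boolP (a \in A).
  rewrite (big_fsetD1 a) //= addrCA lerDl addr_ge0 //.
have := hA _ (fsubsetU1 a A); rewrite big_fsetU1 //=.
have := hA _ (fsubset_refl A).
set S := \sum_(a <- A) f a => h1 h2.
have -> : f a = (l - S) - (l - (f a + S)) by rewrite opprB addrC subrKA addrK.
rewrite (le_trans (ler_normB _ _)) // -[leLHS]addr0 lerD // ltW //.
by rewrite -(_ : 1 + 1 = 2 :> R) // ltrD.
Qed.

(** A family which vanishes outside the range of the injection [phi] may be
   summed along [phi]. *)
Lemma has_sum_reindex (phi psi : I -> I) f l :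
  cancel phi psi -> (forall a, f a != 0 -> phi (psi a) = a) ->
  has_sum (f \o phi) l -> has_sum f l.
Proof.
move=> phiK psiK h e /h[A hA].
exists [fset phi a | a in A]%fset => B AB.
have -> : \sum_(a <- B) f a =
    \sum_(a <- [fset psi b | b in B & phi (psi b) == b]%fset) (f \o phi) a.
  rewrite big_imfset /=; last first.
    move=> x y /andP[_ /eqP ex] /andP[_ /eqP ey] exy.
    by rewrite -ex -ey exy.
  rewrite big_filter [RHS]big_seq_cond [LHS](bigID (fun b => phi (psi b) == b)) /=.
  rewrite [X in _ + X]big1 ?addr0; last first.
    by move=> b nb; apply/eqP; apply: contraNT nb => /psiK ->.
  by rewrite [LHS]big_seq_cond; apply: eq_bigr => b /andP[_ /eqP ->].
apply: hA; apply/fsubsetP => a aA; apply/imfsetP; exists (phi a) => //=.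
  rewrite !inE phiK eqxx andbT; apply: (fsubsetP AB); apply/imfsetP.
  by exists a.
Qed.

End HasSum.

Lemma has_sum_map (R : realType) (I : choiceType) (W W' : normedModType R)
    (f : I -> W) l (u : W -> W') (C : R) :
  zmod_morphism u -> (forall w, `|u w| <= C * `|w|) ->
  has_sum f l -> has_sum (u \o f) (u l).
Proof.
move=> uB hu h e e0.
have u0 : u 0 = 0 by rewrite -(subrr 0) uB subrr.
have uD : {morph u : x y / x + y}.
  by move=> x y; rewrite -[y in LHS]opprK uB -[- y]sub0r uB u0 sub0r opprK.
have C1 : 0 < `|C| + 1 by rewrite ltr_wpDl.
have [A hA] := h _ (divr_gt0 e0 C1); exists A => B /hA.
rewrite ltr_pdivlMr // => lt; rewrite -(big_morph u uD u0) -uB.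
apply: le_lt_trans (hu _) _; apply: le_lt_trans lt.
by rewrite mulrC ler_wpM2l // (le_trans (ler_norm _)) // lerDl.
Qed.

Lemma has_sumZ (R : realType) (I : choiceType) (W : normedModType R)
    (f : I -> W) l (k : R) :
  has_sum f l -> has_sum (fun a => k *: f a) (k *: l).
Proof.
apply: (@has_sum_map R I W W f l ( *:%R k) `|k|) => [x y|w].
  by rewrite scalerBr.
by rewrite normrZ.
Qed.

Lemma has_sum_scaler (R : realType) (I : choiceType) (W : normedModType R)
    (f : I -> R) l (w : W) :
  has_sum (f : I -> R^o) l -> has_sum (fun a => f a *: w) (l *: w).
Proof.
move=> h; apply: (@has_sum_map R I R^o W f l ( *:%R^~ w) `|w|) => // [x y|k].
  by rewrite scalerBl.
by rewrite normrZ mulrC.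
Qed.

(** Absolutely summable families of reals have a sum. *)
Lemma has_sum_real (R : realType) (I : choiceType) (f : I -> R) (M : R) :
  (forall B : {fset I}, \sum_(a <- B) `|f a| <= M) ->
  exists l, has_sum (f : I -> R^o) l.
Proof.
move=> hM.
have pos (g : I -> R) N : (forall a, 0 <= g a) ->
    (forall B : {fset I}, \sum_(a <- B) g a <= N) ->
    exists l, has_sum (g : I -> R^o) l.
  move=> g0 gN; pose S := [set x | exists B : {fset I}, x = \sum_(a <- B) g a].
  have supS : has_sup S.
    split; first by exists (\sum_(a <- fset0) g a); exists fset0.
    by exists N => _ [B ->].
  exists (sup S) => e e0.
  have [_ [A ->] hA] := sup_adherent e0 supS; exists A => B AB.
  have le : \sum_(a <- A) g a <= \sum_(a <- B) g a.
    rewrite [leRHS](big_fsetID _ (mem A)) /=.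
    rewrite [X in _ <= X + _](_ : _ = \sum_(a <- A) g a); last first.
      apply: perm_big; apply: uniq_perm; rewrite ?fset_uniq //.
      move=> x; rewrite !inE /= andbC; case: (boolP (x \in A)) => //= xA.
      by rewrite (fsubsetP AB).
    by rewrite lerDl sumr_ge0.
  rewrite ger0_norm; last first.
    by rewrite subr_ge0 ub_le_sup //; [case: supS|exists B].
  by rewrite ltrBlDr -ltrBlDl (lt_le_trans _ le) // ltrBlDl -ltrBlDr.
(* [f] is the difference of the nonnegative families [f + |f|] and [|f|] *)
have [l1 h1] : exists l, has_sum ((fun a => f a + `|f a|) : I -> R^o) l.
  apply: (pos _ (M + M)) => [a|B].
    by rewrite -lerBlDr sub0r; have := ler_norm (- f a); rewrite normrN lerNl.
  rewrite big_split lerD //; apply: le_trans (hM B).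
  by apply: ler_sum => a _; apply: ler_norm.
have [l2 h2] : exists l, has_sum ((fun a => `|f a|) : I -> R^o) l.
  exact: (pos _ M).
exists (l1 + (-1) * l2).
apply: eq_has_sum (has_sumD h1 (has_sumZ (-1) h2)) => a /=.
by rewrite scaleN1r addrK.
Qed.

(** * The sup norm on row vectors *)

Section RowNorm.
Context {R : realType}.

Lemma coord_le_norm n (y : 'rV[R]_n) i : `|y 0 i| <= `|y|.
Proof.
rewrite [leRHS]/Num.Def.normr /= mx_normrE.
by apply: (le_bigmax _ (fun ij : 'I_1 * 'I_n => `|y ij.1 ij.2|) (0, i)).
Qed.

Lemma row_norm_le n (y : 'rV[R]_n) (e : R) :
  0 <= e -> (forall i, `|y 0 i| <= e) -> `|y| <= e.
Proof.
move=> e0 h; rewrite [leLHS]/Num.Def.normr /= mx_normrE.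
by apply: bigmax_le => // -[i j] _ /=; rewrite (ord1 i).
Qed.

Lemma norm_mulmx_le n m (A : 'M[R]_(n, m)) (y : 'rV[R]_n) :
  `|y *m A| <= (\sum_i \sum_j `|A i j|) * `|y|.
Proof.
have S0 : 0 <= \sum_i \sum_j `|A i j| by do 2!apply: sumr_ge0 => ? _.
apply: row_norm_le; first by rewrite mulr_ge0.
move=> j; rewrite mxE (le_trans (ler_norm_sum _ _ _)) // mulr_suml.
apply: ler_sum => i _; rewrite normrM mulrC ler_pM ?coord_le_norm //.
by rewrite (bigD1 j) //= lerDl sumr_ge0.
Qed.

(** Absolutely summable families of row vectors have a sum. *)
Lemma row_has_sum (I : choiceType) m (f : I -> 'rV[R]_m) (M : R) :
  (forall B : {fset I}, \sum_(a <- B) `|f a| <= M) -> exists l, has_sum f l.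
Proof.
move=> hM.
have h i : exists l, has_sum ((fun a => f a 0 i) : I -> R^o) l.
  apply: (has_sum_real (M := M)) => B; apply: le_trans (hM B).
  by apply: ler_sum => a _; apply: coord_le_norm.
have [l hl] := choice h.
exists (\sum_(i <- enum 'I_m) l i *: delta_mx 0 i).
have hh i : has_sum (fun a => f a 0 i *: (delta_mx 0 i : 'rV[R]_m)) (l i *: delta_mx 0 i).
  exact: has_sum_scaler (hl i).
apply: eq_has_sum (has_sum_sum (enum 'I_m) hh) => a.
by rewrite big_enum /= [RHS]row_sum_delta.
Qed.

End RowNorm.

(** * Second order expansions *)

Section Jet.
Context {R : realType}.
Implicit Types (th P A B G : R).

(** [P = A + B + O(th ^ 2)] with [B = O(th)], the constants adding up to at
   most [G]; such expansions can be multiplied. *)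
Definition jet th P A B G : Prop := exists a b c : R,
  [/\ 0 <= a, 0 <= b & 0 <= c] /\
  [/\ `|A| <= a, `|B| <= th * b, `|P - A - B| <= th ^+ 2 * c & a + b + c <= G].

Lemma jet_mul th P A B G P' A' B' G' : 0 <= th <= 1 ->
  jet th P A B G -> jet th P' A' B' G' ->
  jet th (P * P') (A * A') (A * B' + B * A') (G * G').
Proof.
move=> /andP[th0 th1] [a [b [c [[a0 b0 c0] [hA hB hC hG]]]]]
  [a' [b' [c' [[a0' b0' c0'] [hA' hB' hC' hG']]]]].
exists (a * a'), (a * b' + b * a'),
  (a * c' + c * a' + b * b' + b * c' + c * b' + c * c').
split; first by split; rewrite ?addr_ge0 ?mulr_ge0.
have t2 : 0 <= th ^+ 2 by rewrite exprn_ge0.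
have t3 : th ^+ 3 <= th ^+ 2 by rewrite ler_wiXn2l.
have t4 : th ^+ 4 <= th ^+ 2 by rewrite ler_wiXn2l.
have bd (x y u v : R) n : `|x| <= u -> `|y| <= v -> 0 <= u -> 0 <= v ->
    u * v <= n -> `|x * y| <= n.
  by move=> xu yv u0 v0 uv; rewrite normrM; apply: le_trans uv; apply: ler_pM.
split.
- by rewrite normrM ler_pM.
- rewrite mulrDr; apply: le_trans (ler_normD _ _) _; apply: lerD.
    by apply: (bd _ _ _ _ _ hA hB'); rewrite ?mulr_ge0 // mulrCA.
  by apply: (bd _ _ _ _ _ hB hA'); rewrite ?mulr_ge0 // mulrA.
- set C := P - A - B in hC; set C' := P' - A' - B' in hC'.
  have -> : P * P' - A * A' - (A * B' + B * A') =
    A * C' + C * A' + B * B' + B * C' + C * B' + C * C' by rewrite /C /C'; ring.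
  clearbody C C'; rewrite !mulrDr; repeat (apply: le_trans (ler_normD _ _) _; apply: lerD).
  + apply: (bd _ _ _ _ _ hA hC') => //; first exact: mulr_ge0.
    by rewrite mulrCA.
  + apply: (bd _ _ _ _ _ hC hA') => //; first exact: mulr_ge0.
    by rewrite mulrA.
  + apply: (bd _ _ _ _ _ hB hB'); rewrite ?mulr_ge0 //.
    by rewrite mulrACA expr2.
  + apply: (bd _ _ _ _ _ hB hC'); rewrite ?mulr_ge0 //.
    by rewrite mulrACA -exprS ler_wpM2r // mulr_ge0.
  + apply: (bd _ _ _ _ _ hC hB'); rewrite ?mulr_ge0 //.
    by rewrite mulrACA -exprSr ler_wpM2r // mulr_ge0.
  + apply: (bd _ _ _ _ _ hC hC'); rewrite ?mulr_ge0 //.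
    by rewrite mulrACA -exprD ler_wpM2r // mulr_ge0.
- apply: le_trans (_ : (a + b + c) * (a' + b' + c') <= _); last first.
    by apply: ler_pM; rewrite ?addr_ge0.
  by rewrite le_eqVlt; apply/orP; left; apply/eqP; ring.
Qed.

Lemma jet1 th : jet th 1 1 0 1.
Proof.
exists 1, 0, 0; split; first by split.
by split; rewrite ?subrr ?sub0r ?normrN ?normr0 ?normr1 ?mulr0 ?addr0.
Qed.

Lemma jet_exp th x h (s : R) n : 0 <= th <= 1 -> `|x| <= s -> `|h| <= th * s ->
  jet th ((x + h) ^+ n) (x ^+ n) (n%:R * h * x ^+ n.-1) ((2 * s) ^+ n).
Proof.
move=> th01 xs hs; elim: n => [|n IH]; first by rewrite !mul0r; exact: jet1.
have b : jet th (x + h) x h (2 * s).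
  exists s, s, 0; have -> : x + h - x - h = 0 by ring.
  rewrite normr0 mulr0.
  have s0 : 0 <= s := le_trans (normr_ge0 _) xs.
  by split=> //; split=> //; lra.
have := jet_mul th01 b IH; rewrite -!exprS /=.
congr (jet _ _ _ _ _); case: n {IH} => [|n] /=; first by rewrite expr0; ring.
by rewrite !exprS -!natr1; ring.
Qed.

Lemma jet_prod th (I : eqType) (r : seq I) (P A B G : I -> R) : 0 <= th <= 1 ->
  uniq r -> (forall i, jet th (P i) (A i) (B i) (G i)) ->
  jet th (\prod_(i <- r) P i) (\prod_(i <- r) A i)
    (\sum_(i <- r) B i * \prod_(j <- r | j != i) A j) (\prod_(i <- r) G i).
Proof.
move=> th01 ur h; elim: r ur => [|i r IH] /=.
  by rewrite !big_nil => _; exact: jet1.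
move=> /andP[ir ur]; have := jet_mul th01 (h i) (IH ur).
rewrite !big_cons eqxx /=; congr (jet _ _ _ _ _); rewrite addrC; congr (_ + _).
  congr (_ * _); rewrite [RHS]big_seq_cond [LHS]big_seq; apply: eq_bigl => j.
  by case: eqP => [->|]; rewrite ?andbT //= (negbTE ir).
rewrite big_distrr; apply: eq_big_seq => j jr /=; rewrite big_cons.
have -> : i != j by apply: contraNneq ir => ->.
by rewrite mulrCA.
Qed.
End Jet.

(** * Power series in several variables *)

Section PowerSeries.
Context {R : realType} {N m : nat}.
Local Notation midx := {ffun 'I_N -> nat}.
Local Notation V := 'rV[R]_N.
Local Notation W := 'rV[R]_m.
Implicit Types (a b : midx) (y h : V) (c : midx -> W).

(** The monomial [y ^ a]. *)
Definition monom a y : R := \prod_(i < N) y 0 i ^+ a i.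
(** Lowering and raising the exponent of the variable [i] by one; [down i] does
   nothing to a zero exponent. *)
Definition down i a : midx := [ffun j => (a j - (j == i))%N].
Definition up i a : midx := [ffun j => (a j + (j == i))%N].
(** [t ^ |a|] *)
Definition weight (t : R) a : R := \prod_(i < N) t ^+ a i.

Lemma upK i : cancel (up i) (down i).
Proof. by move=> a; apply/ffunP => j; rewrite !ffunE addnK. Qed.

Lemma downK i a : a i != 0%N -> up i (down i a) = a.
Proof.
move=> ai; apply/ffunP => j; rewrite !ffunE subnK //.
by case: eqP => [->|//]; rewrite lt0n.
Qed.

Lemma weight_ge0 t a : 0 <= t -> 0 <= weight t a.
Proof. by move=> t0; apply: prodr_ge0 => i _; rewrite exprn_ge0. Qed.

Lemma weightM t u a : weight (t * u) a = weight t a * weight u a.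
Proof. by rewrite /weight -big_split; apply: eq_bigr => i _; rewrite exprMn. Qed.

Lemma weight_up t i a : weight t (up i a) = t * weight t a.
Proof.
rewrite /weight [LHS](bigD1 i) // [X in _ = _ * X](bigD1 i) //= ffunE eqxx addn1.
rewrite exprS mulrA; congr (_ * _); apply: eq_bigr => j ji.
by rewrite ffunE (negbTE ji) addn0.
Qed.

Lemma monom_le t a y : `|y| <= t -> `|monom a y| <= weight t a.
Proof.
move=> yt; rewrite normr_prod; apply: ler_prod => i _.
rewrite normr_ge0 normrX lerXn2r ?nnegrE ?(le_trans (coord_le_norm _ _)) //.
exact: le_trans yt.
Qed.

(** The first order term is the differential of the monomial, applied to [h].
   The factor [a i] hides the value of [down i a] when [a i] is zero. *)
Lemma monom_jet th s a y h : 0 <= th <= 1 -> `|y| <= s -> `|h| <= th * s ->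
  jet th (monom a (y + h)) (monom a y)
    (\sum_(i < N) h 0 i * ((a i)%:R * monom (down i a) y)) (weight (2 * s) a).
Proof.
move=> th01 ys hs.
have h1 i : jet th ((y + h) 0 i ^+ a i) (y 0 i ^+ a i)
    ((a i)%:R * h 0 i * y 0 i ^+ (a i).-1) ((2 * s) ^+ a i).
  by rewrite mxE; apply: jet_exp => //; apply: le_trans (coord_le_norm _ _) _.
have := jet_prod th01 (index_enum_uniq _) h1.
congr (jet _ _ _ _ _); apply: eq_bigr => i _.
rewrite /monom [in RHS](bigD1 i) //= ffunE eqxx subn1.
have -> : \prod_(j < N | j != i) y 0 j ^+ down i a j =
    \prod_(j < N | j != i) y 0 j ^+ a j.
  by apply: eq_bigr => j ji; rewrite ffunE (negbTE ji) subn0.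
by ring.
Qed.

(** The sum over all multi-indices of [2 ^ - |a|] is at most [2 ^ N]. *)
Lemma sum_weight_half (B : {fset midx}) : \sum_(a <- B) weight (2^-1) a <= 2 ^+ N.
Proof.
(* [B] lies in a box, over which the sum is a product of geometric sums *)
pose K := (\max_(a <- B) \max_(i < N) a i).+1.
pose emb (f : {ffun 'I_N -> 'I_K}) : midx := [ffun i => nat_of_ord (f i)].
pose S := map emb (enum {ffun 'I_N -> 'I_K}).
have uS : uniq S.
  rewrite map_inj_uniq ?enum_uniq // => f g /ffunP fg; apply/ffunP => i.
  by apply: val_inj; have := fg i; rewrite !ffunE.
have BS : {subset (B : seq _) <= S}.
  move=> a aB; have aK i : (a i < K)%N.
    rewrite ltnS (leq_trans (leq_bigmax i)) //.
    by rewrite (big_fsetD1 a) //= leq_maxl.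
  apply/mapP; exists [ffun i => Ordinal (aK i)]; first by rewrite mem_enum.
  by apply/ffunP => i; rewrite !ffunE.
apply: le_trans (_ : \sum_(a <- S) weight 2^-1 a <= _).
  rewrite [leRHS](bigID (fun a => a \in B)) /= -[X in X + _]big_filter.
  have p : perm_eq [seq i <- S | i \in B] B.
    apply: uniq_perm; rewrite ?fset_uniq ?filter_uniq // => a.
    by rewrite mem_filter andb_idr //; apply: BS.
  by rewrite (perm_big _ p) lerDl sumr_ge0 // => a _; rewrite weight_ge0.
rewrite big_map big_enum /= /weight /emb.
under eq_bigr do under eq_bigr do rewrite ffunE.
rewrite -(bigA_distr_bigA (fun (i : 'I_N) (j : 'I_K) => 2^-1 ^+ j)) /=.
rewrite -[X in 2 ^+ X]card_ord -prodr_const; apply: ler_prod => i _.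
rewrite sumr_ge0 /=; last by move=> j _; rewrite exprn_ge0.
have geo k : \sum_(j < k) (2^-1 : R) ^+ j = 2 - 2 * 2^-1 ^+ k.
  elim: k => [|k IH]; first by rewrite big_ord0; ring.
  by rewrite big_ord_recr /= IH exprS; field.
by rewrite geo lerBlDr lerDl mulr_ge0 // exprn_ge0.
Qed.

(** Coefficients of the partial derivative. *)
Definition dcoef i c : midx -> W := fun b => (b i).+1%:R *: c (up i b).

(** Halving the radius absorbs the factor [b i + 1], which is at most
   [2 ^ b i]. *)
Lemma dcoef_bound c (M t : R) i : 0 < t -> (forall a, weight t a * `|c a| <= M) ->
  forall b, weight (t / 2) b * `|dcoef i c b| <= M / t.
Proof.
move=> t0 hM b; rewrite /dcoef normrZ ger0_norm // weightM.
have := hM (up i b); rewrite weight_up ler_pdivlMr // => {}hM.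
apply: le_trans hM.
have w : weight 2^-1 b * (b i).+1%:R <= 1.
  rewrite /weight (bigD1 i) //= mulrAC -[leRHS]mulr1.
  have p1 : 0 <= \prod_(j < N | j != i) (2^-1 : R) ^+ b j <= 1.
    apply/andP; split; first by apply: prodr_ge0 => j _; rewrite exprn_ge0.
    apply: le_trans (_ : \prod_(j < N | j != i) (1 : R) <= _); last by rewrite big1.
    apply: ler_prod => j _; rewrite exprn_ge0 //=.
    by rewrite exprn_ile1 // invf_le1 // ler1n.
  case/andP: p1 => p0 p1.
  rewrite ler_pM // ?mulr_ge0 ?exprn_ge0 // exprVn ler_pdivrMl ?exprn_gt0 // mulr1.
  by rewrite -natrX ler_nat ltn_expl.
have := ler_wpM2r (mulr_ge0 (mulr_ge0 (ltW t0) (weight_ge0 b (ltW t0))) (normr_ge0 (c (up i b)))) w.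
by rewrite mul1r; apply: le_trans; rewrite le_eqVlt; apply/orP; left; apply/eqP; ring.
Qed.

Lemma series_exists c (M t : R) y : 0 < t -> (forall a, weight t a * `|c a| <= M) ->
  `|y| <= t / 2 -> exists l : W, has_sum (fun a => monom a y *: c a) l.
Proof.
move=> t0 hM yt; apply: (row_has_sum (M := M * 2 ^+ N)) => B.
have M0 : 0 <= M.
  by apply: le_trans (hM [ffun=> 0%N]); rewrite mulr_ge0 // weight_ge0 // ltW.
apply: le_trans (ler_wpM2l M0 (sum_weight_half B)); rewrite big_distrr /=.
apply: ler_sum => a _; rewrite normrZ.
apply: le_trans (ler_wpM2r (normr_ge0 _) (monom_le a yt)) _.
rewrite weightM mulrAC ler_wpM2r // weight_ge0 //.
Qed.

(** Convergence at the corner [(t, ..., t)] of the polydisc of radius [t] bounds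
   the coefficients. *)
Lemma series_bounded c (G : V -> W) (t : R) : 0 < t ->
  (forall y, `|y| <= t -> has_sum (fun a => monom a y *: c a) (G y)) ->
  exists M, forall a, weight t a * `|c a| <= M.
Proof.
move=> t0 h; have yt : `|const_mx t : V| <= t.
  apply: row_norm_le => [|i]; first exact: ltW.
  by rewrite mxE ger0_norm // ltW.
have [M hM] := has_sum_term_bounded (h _ yt); exists M => a.
apply: le_trans (hM a); rewrite normrZ ler_wpM2r //.
rewrite ger0_norm; last by apply: prodr_ge0 => i _; rewrite mxE exprn_ge0 // ltW.
by rewrite /monom /weight; under [leRHS]eq_bigr do rewrite mxE.
Qed.

(** The power series with coefficients [dcoef i c] is the series of the partial
   derivatives of the terms, reindexed by [up i]. *)
Lemma series_derivative_sum c i y (l : W) :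
  has_sum (fun b => monom b y *: dcoef i c b) l ->
  has_sum (fun a => ((a i)%:R * monom (down i a) y) *: c a) l.
Proof.
move=> h; apply: (has_sum_reindex (upK i)) => [a|].
  move=> na; apply: downK; apply: contraNneq na => ->.
  by rewrite mul0r scale0r.
apply: eq_has_sum h => b /=; rewrite upK ffunE eqxx addn1 /dcoef scalerA.
by rewrite mulrC.
Qed.

(** Termwise differentiation, with a uniform quadratic remainder. *)
Lemma series_expansion c (M t : R) (G : V -> W) (D : 'I_N -> V -> W) : 0 < t ->
  (forall a, weight t a * `|c a| <= M) ->
  (forall y, `|y| <= t / 2 -> has_sum (fun a => monom a y *: c a) (G y)) ->
  (forall i y, `|y| <= t / 4 ->
     has_sum (fun b => monom b y *: dcoef i c b) (D i y)) ->
  exists2 C, 0 <= C & forall y h, `|y| <= t / 4 -> `|h| <= t / 4 ->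
    `|G (y + h) - G y - \sum_(i < N) h 0 i *: D i y| <= C * `|h| ^+ 2.
Proof.
move=> t0 hM hG hD; set s := t / 4; have s0 : 0 < s by rewrite divr_gt0.
have M0 : 0 <= M.
  by apply: le_trans (hM [ffun=> 0%N]); rewrite mulr_ge0 // weight_ge0 // ltW.
exists (s ^- 2 * (M * 2 ^+ N)); first by rewrite !mulr_ge0 // ?invr_ge0 ?exprn_ge0 // ltW.
move=> y h ys hs; pose th := `|h| / s.
have th01 : 0 <= th <= 1 by rewrite divr_ge0 ?(ltW s0) //= ler_pdivrMr // mul1r.
have hth : `|h| <= th * s by rewrite /th mulfVK // gt_eqF.
have st : s + s = t / 2 by rewrite /s; lra.
have st' : s <= t / 2 by rewrite -st lerDl ltW.
have yh : `|y + h| <= t / 2.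
  by rewrite (le_trans (ler_normD _ _)) // -st lerD.
pose f a := (monom a (y + h) - monom a y -
   \sum_(i < N) h 0 i * ((a i)%:R * monom (down i a) y)) *: c a.
have hf : has_sum f (G (y + h) - G y - \sum_(i < N) h 0 i *: D i y).
  have hB : has_sum (fun a => \sum_(i < N) h 0 i *: (((a i)%:R * monom (down i a) y) *: c a))
     (\sum_(i < N) h 0 i *: D i y).
    by apply: has_sum_sum => i; apply: has_sumZ; apply: series_derivative_sum; apply: hD.
  have h1 := has_sumD (hG _ yh) (has_sumZ (-1) (hG _ (le_trans ys st'))).
  have := has_sumD h1 (has_sumZ (-1) hB); rewrite !scaleN1r.
  apply: eq_has_sum => a; rewrite /f !scaleN1r !scalerBl scaler_suml.
  by under [in RHS]eq_bigr do rewrite -scalerA.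
have bd a : `|f a| <= th ^+ 2 * (M * weight 2^-1 a).
  rewrite /f normrZ.
  have [u [v [w [[u0 v0 w0] [_ _ hw hG']]]]] := monom_jet a th01 ys hth.
  apply: le_trans (ler_wpM2r (normr_ge0 _) hw) _.
  rewrite -mulrA ler_wpM2l ?exprn_ge0 //; first by case/andP: th01.
  apply: le_trans (_ : weight (2 * s) a * `|c a| <= _).
    by rewrite ler_wpM2r // (le_trans _ hG') // lerDr addr_ge0.
  have -> : 2 * s = t * 2^-1 by rewrite /s; lra.
  by rewrite weightM mulrAC ler_wpM2r // weight_ge0.
apply: le_trans (has_sum_norm_le (M := th ^+ 2 * (M * 2 ^+ N)) hf bd _) _.
  move=> B; rewrite -!big_distrr /= ler_wpM2l ?exprn_ge0 //; first by case/andP: th01.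
  by rewrite ler_wpM2l // sum_weight_half.
by rewrite /th expr_div_n; rewrite le_eqVlt; apply/orP; left; apply/eqP; ring.
Qed.

(** Near [p], a map analytic at [p] is differentiable with a uniform quadratic
   remainder, and its partial derivatives are again analytic at [p]. *)
Lemma analytic_expansion (F : V -> W) p : real_analytic_at F p ->
  exists (D : 'I_N -> V -> W) (d C : R), [/\ 0 < d, 0 <= C,
    forall i, real_analytic_at (D i) p
  & forall x h, `|x - p| < d -> `|h| < d ->
     `|F (x + h) - F x - \sum_(i < N) h 0 i *: D i x| <= C * `|h| ^+ 2].
Proof.
case=> c /nbhs_ballP[r /= r0 hr]; pose t := r / 2.
have t0 : 0 < t by rewrite divr_gt0.
have hF y : `|y| <= t -> has_sum (fun a => monom a y *: c a) (F (p + y)).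
  move=> yt; have := hr (p + y); rewrite -ball_normE /= opprD addNKr normrN.
  have yr : `|y| < r by rewrite (le_lt_trans yt) // /t ltr_pdivrMr // ltr_pMr // ltr1n.
  by move=> /(_ yr); rewrite addrAC subrr add0r.
have [M hM] := series_bounded t0 hF.
have hD i y : exists l : W, `|y| <= t / 4 -> has_sum (fun b => monom b y *: dcoef i c b) l.
  have [le|] := leP `|y| (t / 4); last by exists 0.
  have t2 : 0 < t / 2 by rewrite divr_gt0.
  have le2 : `|y| <= t / 2 / 2 by apply: le_trans le _; lra.
  by have [l hl] := series_exists t2 (dcoef_bound i t0 hM) le2; exists l.
pose D0 i := projT1 (choice (hD i)).
have hD0 i y : `|y| <= t / 4 ->
    has_sum (fun b => monom b y *: dcoef i c b) (D0 i y).
  exact: (projT2 (choice (hD i))).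
have tt : t / 2 <= t by rewrite ler_pdivrMr // ler_peMr ?ltW // ltr1n.
have [C C0 hC] := series_expansion t0 hM (fun y yt => hF y (le_trans yt tt)) hD0.
exists (fun i x => D0 i (x - p)), (t / 4), C; split => //.
- by rewrite divr_gt0.
- move=> i; exists (dcoef i c); apply/nbhs_ballP; exists (t / 4) => /=.
    by rewrite divr_gt0.
  move=> x; rewrite -ball_normE /= distrC => xp.
  by apply: hD0; rewrite ltW.
- move=> x h xp ht; have := hC (x - p) h (ltW xp) (ltW ht).
  have -> : p + (x - p + h) = x + h by rewrite addrA (addrC p) subrK.
  by have -> : p + (x - p) = x by rewrite addrC subrK.
Qed.

End PowerSeries.

(** * Analytic maps *)

Lemma near0_norm_lt (R : realType) (V : normedModType R) (d : R) :
  0 < d -> \forall h \near (0 : V), `|h| < d.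
Proof.
move=> d0; apply/nbhs_ballP; exists d => //= h.
by rewrite -ball_normE /= sub0r normrN.
Qed.

Section Differentiability.
Context {R : realType} {N m : nat}.
Local Notation V := 'rV[R]_N.
Local Notation W := 'rV[R]_m.
Implicit Types (F G : V -> W).

Lemma mulmxr_continuous (A : 'M[R]_(N, m)) : continuous (fun v : V => v *m A : W).
Proof.
move=> x; apply/(@cvgrPdist_le _ _ _ (nbhs x)) => /= e e0; set K := \sum_i \sum_j `|A i j|.
have K0 : 0 <= K by do 2!apply: sumr_ge0 => ? _.
have K1 : 0 < K + 1 by rewrite ltr_wpDl.
apply/nbhs_ballP; exists (e / (K + 1)) => /=; first by rewrite divr_gt0.
move=> y; rewrite -ball_normE /= ltr_pdivlMr // => h; rewrite -mulmxBl.
apply: le_trans (norm_mulmx_le _ _) _; apply: le_trans (ltW h).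
by rewrite mulrC ler_wpM2l // lerDl.
Qed.

(** A quadratic remainder determines the differential. *)
Lemma diff_of_expansion F (x : V) (A : 'M[R]_(N, m)) (d C : R) : 0 < d -> 0 <= C ->
  (forall h, `|h| < d -> `|F (x + h) - F x - h *m A| <= C * `|h| ^+ 2) ->
  differentiable F x /\ forall v, 'd F x v = v *m A.
Proof.
move=> d0 C0 hF; have C1 : 0 < C + 1 by rewrite ltr_wpDl.
have lo : F \o shift x = cst (F x) + mulmxr A +o_ (0 : V) id.
  apply/eqaddoP => _/posnumP[e]; near=> h.
  have -> : (F \o shift x - (cst (F x) + mulmxr A)) h = F (x + h) - F x - h *m A.
    by rewrite /= !fctE /= opprD addrA [h + x]addrC.
  apply: le_trans (hF _ _) _; first by near: h; exact: (@near0_norm_lt R V).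
  rewrite expr2 mulrA ler_wpM2r //.
  have hl : `|h| <= e%:num / (C + 1).
    by apply: ltW; near: h; apply: (@near0_norm_lt R V); rewrite divr_gt0.
  apply: le_trans (ler_wpM2l C0 hl) _.
  by rewrite mulrCA ler_piMr // ler_pdivrMr // mul1r lerDl.
have dE := @diff_unique R V W F (mulmxr A) x (@mulmxr_continuous A) lo.
split; last by move=> v; rewrite dE.
by apply/diff_locallyP; rewrite dE; split => //; exact: mulmxr_continuous.
Unshelve. all: by end_near. Qed.

Lemma near_eq_analytic F G p : (\near p, F p = G p) ->
  real_analytic_at F p -> real_analytic_at G p.
Proof.
move=> FG [c hc]; exists c; near=> x.
have <- : F x = G x by near: x.
by near: x.
Unshelve. all: by end_near. Qed.

Lemma analytic_sum (J : Type) (r : seq J) (F : J -> V -> W) p :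
  (forall j, real_analytic_at (F j) p) ->
  real_analytic_at (fun x => \sum_(j <- r) F j x) p.
Proof.
move=> h; elim: r => [|j r [c hc]].
  by exists (fun=> 0); near=> x; rewrite big_nil;
    apply: (eq_has_sum _ (@has_sum0 _ _ _)) => a; rewrite scaler0.
have [c' hc'] := h j; exists (fun a => c' a + c a); near=> x; rewrite big_cons.
have h1 : has_sum (fun a => monom a (x - p) *: c' a) (F j x) by near: x.
have h2 : has_sum (fun a => monom a (x - p) *: c a) (\sum_(j <- r) F j x).
  by near: x.
by apply: eq_has_sum (has_sumD h1 h2) => a; rewrite scalerDr.
Unshelve. all: by end_near. Qed.

Lemma analyticD F G p : real_analytic_at F p -> real_analytic_at G p ->
  real_analytic_at (fun x => F x + G x) p.
Proof.
move=> hF hG; have hj (b : bool) : real_analytic_at (if b then F else G) p.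
  by case: b.
apply: near_eq_analytic (analytic_sum [:: true; false] hj).
by near=> x; rewrite !big_cons big_nil addr0.
Unshelve. all: by end_near. Qed.

Lemma analyticZ F (k : R) p : real_analytic_at F p ->
  real_analytic_at (fun x => k *: F x) p.
Proof.
move=> [c hc]; exists (fun a => k *: c a); near=> x.
have h1 : has_sum (fun a => monom a (x - p) *: c a) (F x) by near: x.
by apply: eq_has_sum (has_sumZ k h1) => a; rewrite scalerA mulrC -scalerA.
Unshelve. all: by end_near. Qed.

Lemma analytic_monom (a : {ffun 'I_N -> nat}) (w : W) p :
  real_analytic_at (fun x : V => monom a (x - p) *: w) p.
Proof.
exists (fun b => if b == a then w else 0); near=> x => e e0.
exists [fset a]%fset => B aB.
rewrite (big_fsetD1 a) /=; last by rewrite (fsubsetP aB) ?inE.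
have z : \sum_(b <- (B `\ a)%fset)
    monom b (x - p) *: (if b == a then w else 0) = 0.
  rewrite big_seq big1 // => b.
  by rewrite !inE => /andP[/negbTE -> _]; rewrite scaler0.
by rewrite eqxx [X in _ - (_ + X)]z addr0 subrr normr0.
Unshelve. all: by end_near. Qed.

Lemma analytic_cst (w : W) p : real_analytic_at (fun _ : V => w) p.
Proof.
apply: near_eq_analytic (analytic_monom [ffun=> 0%N] w p); near=> x.
by rewrite /monom big1 ?scale1r // => j _; rewrite ffunE.
Unshelve. all: by end_near. Qed.

Lemma analytic_coordX i (d : nat) (w : W) p :
  real_analytic_at (fun x : V => (x 0 i) ^+ d *: w) p.
Proof.
have mon e : real_analytic_at (fun x : V => ((x - p) 0 i) ^+ e *: w) p.
  apply: near_eq_analytic (analytic_monom [ffun j => ((j == i) * e)%N] w p).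
  near=> x; congr (_ *: _); rewrite /monom (bigD1 i) //= ffunE eqxx mul1n.
  by rewrite big1 ?mulr1 // => j /negbTE ji; rewrite ffunE ji.
(* binomial expansion of [x i = (x - p) i + p i] *)
have hj : forall e, real_analytic_at
    (fun x : V => ((p 0 i) ^+ (d - e) *+ 'C(d, e)) *: (((x - p) 0 i) ^+ e *: w)) p.
  by move=> e; apply: analyticZ.
apply: near_eq_analytic (analytic_sum (iota 0 d.+1) hj).
near=> x; rewrite -[x in RHS](subrK p) [in RHS]mxE addrC exprDn scaler_suml.
rewrite -{1}[d.+1]subn0 -/(index_iota 0 d.+1) big_mkord.
by apply: eq_bigr => e _; rewrite scalerA mulrnAl.
Unshelve. all: by end_near. Qed.

(** An analytic map is strictly differentiable, and its directional derivatives
   are analytic. *)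
Lemma analytic_strict F p : real_analytic_at F p ->
  [/\ differentiable F p,
      forall v, real_analytic_at ('D_v F) p
    & forall e, 0 < e -> exists2 d, 0 < d & forall x y, `|x - p| < d ->
        `|y - p| < d -> `|F x - F y - 'd F p (x - y)| <= e * `|x - y|].
Proof.
move=> hF.
have [D [d [C [d0 C0 hD hE]]]] := analytic_expansion hF.
pose A (x : V) := \matrix_(i < N) D i x.
have AE (x h : V) : \sum_(i < N) h 0 i *: D i x = h *m A x.
  by rewrite mulmx_sum_row; apply: eq_bigr => i _; rewrite rowK.
have dF (x : V) : `|x - p| < d -> differentiable F x /\ forall v, 'd F x v = v *m A x.
  move=> xd; apply: (diff_of_expansion d0 C0) => h hd.
  by rewrite -AE; apply: hE.
have pd : `|p - p| < d by rewrite subrr normr0.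
have [dFp dFE] := dF _ pd.
split=> //.
  move=> v; apply: near_eq_analytic (analytic_sum (enum 'I_N) (fun i => analyticZ (v 0 i) (hD i))).
  apply/nbhs_ballP; exists d => //= x; rewrite -ball_normE /= distrC => xd.
  have [dx dxE] := dF _ xd.
  have dv : 'D_v F x = v *m A x by rewrite -dxE; apply: deriveE.
  by rewrite dv -(AE x v) big_enum.
move=> e e0.
have e1 : 0 < e / 2 / N.+1%:R by rewrite !divr_gt0.
have Dc : \forall y \near p, forall i, `|D i y - D i p| <= e / 2 / N.+1%:R.
  apply: (@filter_forall _ _
    (fun i => [set y | `|D i y - D i p| <= e / 2 / N.+1%:R]) (nbhs p) _) => i.
  have [D' [d' [C' [d0' C0' _ hE']]]] := analytic_expansion (hD i).
  have : differentiable (D i) p.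
    have := @diff_of_expansion (D i) p (\matrix_(i < N) D' i p) d' C' d0' C0'.
    case=> // h hd; rewrite mulmx_sum_row.
    under eq_bigr do rewrite rowK.
    by apply: hE' => //; rewrite subrr normr0.
  move=> /differentiable_continuous /cvgrPdist_le /(_ _ e1).
  by apply: filterS => y; rewrite distrC.
have /nbhs_ballP[d1 /= d10 hd1] := Dc.
(* the remainder between [y] and [x] is [C * |h| ^ 2], and replacing the
   differential at [y] by the one at [p] costs at most [e / 2 * |h|] near [p] *)
pose d2 : R := Num.min (Num.min d1 (d / 2)) (e / (2 * (C + 1)) / 2).
have C1 : 0 < 2 * (C + 1) by rewrite mulr_gt0 // ltr_wpDl.
have d20 : 0 < d2 by rewrite !lt_min d10 !divr_gt0.
exists d2 => // x y; rewrite !lt_min => /andP[/andP[xd1 xd] xe] /andP[/andP[yd1 yd] ye].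
pose h := x - y; have xE : x = y + h by rewrite addrC subrK.
have hle : `|h| <= `|x - p| + `|y - p|.
  by rewrite /h -(subrKA p) -(opprB y p) (le_trans (ler_normB _ _)).
have hd : `|h| < d by rewrite (le_lt_trans hle) // (splitr d) ltrD.
have he : `|h| <= e / (2 * (C + 1)).
  by rewrite (le_trans hle) // [leRHS]splitr ltW // ltrD.
have yd' : `|y - p| < d by apply: lt_trans yd _; rewrite ltr_pdivrMr // ltr_pMr // ltr1n.
have := hE y h yd' hd; rewrite -xE -/h dFE => h1.
have -> : F x - F y - h *m A p =
   (F x - F y - \sum_(i < N) h 0 i *: D i y) + \sum_(i < N) h 0 i *: (D i y - D i p).
  under [X in _ = _ + X]eq_bigr do rewrite scalerBr.
  by rewrite sumrB !AE addrA subrK.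
apply: le_trans (ler_normD _ _) _; rewrite [e]splitr mulrDl; apply: lerD.
  apply: le_trans h1 _; rewrite expr2 mulrA ler_wpM2r //.
  apply: le_trans (ler_wpM2l C0 he) _.
  have C2 : 0 < C + 1 by rewrite ltr_wpDl.
  have -> : C * (e / (2 * (C + 1))) = e / 2 * (C / (C + 1)).
    by field; rewrite gt_eqF.
  by rewrite ler_piMr ?ler_pdivrMr ?mul1r ?lerDl // divr_ge0 // ltW.
apply: le_trans (ler_norm_sum _ _ _) _.
apply: le_trans (_ : \sum_(i < N) e / 2 / N.+1%:R * `|h| <= _).
  apply: ler_sum => i _; rewrite normrZ mulrC ler_pM ?coord_le_norm //.
  by apply: hd1; rewrite -ball_normE /= distrC.
rewrite sumr_const card_ord -[leLHS]mulr_natl mulrA ler_wpM2r // mulrCA ler_piMr //.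
  by rewrite divr_ge0 // ltW.
by rewrite ler_pdivrMr // mul1r ler_nat.
Qed.

Lemma analytic_smooth (U : set V) F : (forall x, U x -> real_analytic_at F x) ->
  smooth_on U F.
Proof.
move=> hF vs x Ux.
have h : forall y, U y -> real_analytic_at (foldr (fun v h => 'D_v h) F vs) y.
  elim: vs => [|v vs IH] y Uy; first exact: hF.
  by have [_ h _] := analytic_strict (IH y Uy); apply: h.
by have [] := analytic_strict (h x Ux).
Qed.

Lemma diff_coord F x v i : differentiable F x ->
  differentiable (fun q => F q 0 i : R^o) x /\
  'd (fun q => F q 0 i : R^o) x v = 'd F x v 0 i.
Proof.
move=> dF; have dc : differentiable (fun q => F q 0 i : R^o) x.
  exact: (differentiable_comp dF (differentiable_coord _ _ _)).
split=> //; rewrite -!deriveE // derive_mx; last exact: diff_derivable.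
by rewrite mxE.
Qed.

End Differentiability.

Lemma analytic_mulmx (R : realType) (N m l : nat) (F : 'rV[R]_N -> 'rV[R]_m)
    (A : 'M[R]_(m, l)) p :
  real_analytic_at F p -> real_analytic_at (fun x => F x *m A) p.
Proof.
move=> [c hc]; exists (fun a => c a *m A); near=> x.
have h1 : has_sum (fun a => monom a (x - p) *: c a) (F x) by near: x.
have := has_sum_map (u := mulmxr A) _ (norm_mulmx_le A) h1.
move=> /(_ (fun u v => mulmxBl u v A)); apply: eq_has_sum => a /=.
by rewrite scalemxAl.
Unshelve. all: by end_near. Qed.

(** * Curves in the fibre of a submersion *)

(** Row vectors form a complete normed module. *)
HB.instance Definition _ (R : realType) (c : nat) :=
  Uniform_isComplete.Build 'rV[R]_c cauchy_cvg.

(** A map of a closed ball which is a contraction by one half and moves the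
   centre by at most half the radius has a fixed point. *)
Lemma ball_fixed_point (R : realType) c (f : 'rV[R]_c -> 'rV[R]_c) (e : R) :
  0 <= e -> `|f 0| <= e / 2 ->
  (forall y y', `|y| <= e -> `|y'| <= e -> `|f y - f y'| <= `|y - y'| / 2) ->
  exists2 y, `|y| <= e & y = f y.
Proof.
move=> e0 f0 lip.
pose U : set 'rV[R]_c := closed_ball_ Num.norm 0 e.
have UE y : U y = (`|y| <= e) by rewrite /U /closed_ball_ /= sub0r normrN.
have fU : {homo f : y / U y >-> U y}.
  move=> y /=; rewrite !UE => ye; rewrite -[f y](subrK (f 0)).
  apply: le_trans (ler_normD _ _) _; rewrite [e]splitr lerD //.
  apply: le_trans (lip _ _ ye _) _; first by rewrite normr0.
  by rewrite subr0 ler_pM2r.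
have half : 0 <= (2^-1 : R) by [].
have := @banach_fixed_point R 'rV[R]_c U (mkfun_fun fU).
case.
- exists (NngNum half); split=> /=; first by rewrite invf_lt1 // ltr1n.
  move=> [y y'] /= [Uy Uy']; rewrite mulrC; apply: lip.
    by rewrite -UE.
  by rewrite -UE.
- exact: closed_closed_ball_.
- by exists 0; rewrite UE normr0.
- by move=> y; rewrite UE => ye yf; exists y.
Qed.

(** Every vector killed by the differential of a strictly differentiable
   submersion is the velocity of a curve in the fibre. *)
Lemma kernel_velocity (R : realType) N c (g : 'rV[R]_N -> 'rV[R]_c)
    (J : 'M[R]_(N, c)) (z v : 'rV[R]_N) :
  g z = 0 ->
  (forall e, 0 < e -> exists2 d, 0 < d & forall x y, `|x - z| < d ->
     `|y - z| < d -> `|g x - g y - (x - y) *m J| <= e * `|x - y|) ->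
  \rank J = c -> v *m J = 0 ->
  exists gamma : R -> 'rV[R]_N, [/\ gamma 0 = z,
    \forall t \near (0 : R), g (gamma t) = 0
    & is_derive (0 : R) (1 : R) gamma v].
Proof.
move=> gz strict rJ vJ.
have /row_fullP[A AJ] : row_full J by rewrite /row_full rJ.
pose K : R := \sum_i \sum_j `|A i j| + 1.
have K0 : 0 < K by rewrite ltr_wpDl //; do 2!apply: sumr_ge0 => ? _.
have AK (y : 'rV[R]_c) : `|y *m A| <= K * `|y|.
  by apply: le_trans (norm_mulmx_le _ _) _; rewrite ler_wpM2r // lerDl.
have K20 : 0 < (2 * K)^-1 by rewrite invr_gt0 mulr_gt0.
have [d d0 hd] := strict _ K20.
pose eta := d / 2 / (2 * K); have eta0 : 0 < eta by rewrite divr_gt0 ?mulr_gt0 // divr_gt0.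
have zz (e : R) : 0 < e -> `|z - z| < e by rewrite subrr normr0.
have linz e : 0 < e -> \forall t \near (0 : R), `|g (z + t *: v)| <= e * `|t|.
  move=> e0; have v1 : 0 < `|v| + 1 by rewrite ltr_wpDl.
  have [d' d'0 hd'] := strict _ (divr_gt0 e0 v1).
  apply/nbhs_ballP; exists (d' / (`|v| + 1)) => /=; first by rewrite divr_gt0.
  move=> t; rewrite /ball /= sub0r normrN ltr_pdivlMr // => td.
  have tv : `|t *: v| < d'.
    by rewrite normrZ; apply: le_lt_trans td; rewrite ler_wpM2l // lerDl.
  have ztv : z + t *: v - z = t *: v by rewrite addrC addKr.
  have := hd' (z + t *: v) z; rewrite ztv => /(_ tv (zz _ d'0)).
  rewrite gz subr0 -scalemxAl vJ scaler0 subr0 normrZ => h.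
  apply: le_trans h _.
  have -> : e / (`|v| + 1) * (`|t| * `|v|) = e * `|t| * (`|v| / (`|v| + 1)) by ring.
  rewrite ler_piMr ?mulr_ge0 ?(ltW e0) //.
  by rewrite ler_pdivrMr // mul1r lerDl.
(* correct [z + t v] to a point of the fibre by a vector [y *m A], where [A] is a
   right inverse of the differential: the simplified Newton iteration
   [y |-> y - g (z + t v + y *m A)] is a contraction *)
have sol : \forall t \near (0 : R), exists y,
    g (z + t *: v + y *m A) = 0 /\ `|y| <= 2 * `|g (z + t *: v)|.
  have [d' /= d'0 hd'] : \forall t \near (0 : R),
      `|g (z + t *: v)| <= eta / 2 /\ `|t *: v| < d / 2.
    have v1 : 0 < `|v| + 1 by rewrite ltr_wpDl.
    near=> t; split.
      apply: le_trans (_ : 1 * `|t| <= _); first by near: t; exact: linz.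
      rewrite mul1r; apply: ltW; near: t; apply: (@near0_norm_lt R R).
      by rewrite divr_gt0.
    rewrite normrZ; apply: le_lt_trans (_ : `|t| * (`|v| + 1) < _).
      by rewrite ler_wpM2l // lerDl.
    rewrite -ltr_pdivlMr //; near: t; apply: (@near0_norm_lt R R).
    by rewrite !divr_gt0.
  exists d' => // t /hd'[gt tv].
  pose f y := y - g (z + t *: v + y *m A).
  have inb y : `|y| <= eta -> `|z + t *: v + y *m A - z| < d.
    move=> ye; have -> : z + t *: v + y *m A - z = t *: v + y *m A.
      by apply/eqP; rewrite subr_eq (addrC _ z) addrA.
    apply: le_lt_trans (ler_normD _ _) _; rewrite [d]splitr ltr_leD //.
    apply: le_trans (AK y) _; rewrite mulrC -ler_pdivlMr //.
    apply: le_trans ye _; rewrite /eta ler_pM2l ?divr_gt0 //.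
    by rewrite lef_pV2 ?posrE ?mulr_gt0 // ler_peMl ?ltW // ltr1n.
  have lip y y' : `|y| <= eta -> `|y'| <= eta -> `|f y - f y'| <= `|y - y'| / 2.
    move=> ye ye'; have := hd _ _ (inb _ ye) (inb _ ye').
    set x := z + _ + y *m A; set x' := z + _ + y' *m A.
    have xx : x - x' = (y - y') *m A.
      by rewrite /x /x' opprD addrACA subrr add0r mulmxBl.
    rewrite xx -mulmxA AJ mulmx1 => h.
    have -> : f y - f y' = - (g x - g x' - (y - y')).
      by rewrite /f -/x -/x' [RHS]opprB [in LHS]opprD [LHS]addrACA -[in LHS]opprD.
    rewrite normrN; apply: le_trans h _.
    apply: le_trans (ler_wpM2l (ltW K20) (AK _)) _.
    by rewrite invfM mulrA mulrVK ?unitfE ?gt_eqF // mulrC.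
  have [|y ye yf] := @ball_fixed_point R c f eta (ltW eta0) _ lip.
    by rewrite /f mul0mx addr0 sub0r normrN.
  have g0 : g (z + t *: v + y *m A) = 0.
    by move/eqP: yf; rewrite /f eq_sym subr_eq addrC -subr_eq subrr eq_sym => /eqP.
  exists y; split=> //.
  have := lip y 0 ye; rewrite normr0 (ltW eta0) => /(_ isT).
  rewrite -yf subr0 /f mul0mx addr0 sub0r opprK => h.
  have := ler_normB (y + g (z + t *: v)) (g (z + t *: v)); rewrite addrK => h'.
  by lra.
have ch t : exists y, (exists y', g (z + t *: v + y' *m A) = 0 /\ `|y'| <= 2 * `|g (z + t *: v)|) ->
    g (z + t *: v + y *m A) = 0 /\ `|y| <= 2 * `|g (z + t *: v)|.
  have [[y hy]|h] := pselect (exists y',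
    g (z + t *: v + y' *m A) = 0 /\ `|y'| <= 2 * `|g (z + t *: v)|).
    by exists y.
  by exists 0 => /h.
have [y hy] := choice ch.
have y00 : y 0 = 0.
  have [_] := hy 0 (nbhs_singleton sol); rewrite scale0r addr0 gz normr0 mulr0.
  by rewrite normr_le0 => /eqP.
exists (fun t => z + t *: v + y t *m A).
have cv : (fun h : R => h^-1 *: ((z + (h *: 1 + 0) *: v + y (h *: (1 : R) + 0) *m A) -
     (z + 0 *: v + y 0 *m A))) @ (0 : R)^' --> v.
  apply/cvgrPdist_le => e e0.
  have e1 : 0 < e / (2 * K) by rewrite divr_gt0 // mulr_gt0.
  near=> h.
  have h0 : h != 0 by near: h; exact: nbhs_dnbhs_neq.
  have -> : h *: (1 : R) = h by rewrite /GRing.scale /= mulr1.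
  rewrite y00 mul0mx scale0r !addr0.
  have -> : z + h *: v + y h *m A - z = h *: v + y h *m A.
    by apply/eqP; rewrite subr_eq (addrC _ z) addrA.
  rewrite scalerDr scalerA mulVf // scale1r opprD addrA subrr sub0r normrN normrZ.
  have [|_ yh] := hy h.
    by near: h; apply: nbhs_dnbhs; exact: sol.
  have gh : `|g (z + h *: v)| <= e / (2 * K) * `|h|.
    by near: h; apply: nbhs_dnbhs; exact: linz.
  rewrite normfV mulrC ler_pdivrMr ?normr_gt0 //.
  apply: le_trans (AK _) _; apply: le_trans (ler_wpM2l (ltW K0) yh) _.
  rewrite mulrA [K * 2]mulrC; apply: le_trans (ler_wpM2l _ gh) _.
    by rewrite mulr_ge0 // ltW.
  by rewrite mulrA mulrCA divff ?mulr1 // mulf_neq0 // gt_eqF.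
split.
- by rewrite y00 mul0mx scale0r !addr0.
- by apply: filterS sol => t /hy[].
- by apply: DeriveDef; [apply/cvg_ex; exists v|apply: cvg_lim].
Unshelve. all: by end_near. Qed.

(** * The contact form *)

Section ContactForm.
Context {R : realType} {n : nat}.
Local Notation V := 'rV[R]_(n + n).
Implicit Types (z u v : V).

Lemma alpha_linearl z v k u : alpha (k *: u + v) z = k * alpha u z + alpha v z.
Proof.
rewrite /alpha mulrCA -mulrDr; congr (_ * _).
rewrite big_distrr -big_split; apply: eq_bigr => i _ /=.
by rewrite /xcoord /ycoord !mxE; ring.
Qed.

Lemma alpha_linearr z v k u : alpha z (k *: u + v) = k * alpha z u + alpha z v.
Proof.
rewrite /alpha mulrCA -mulrDr; congr (_ * _).
rewrite big_distrr -big_split; apply: eq_bigr => i _ /=.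
by rewrite /xcoord /ycoord !mxE; ring.
Qed.

(** [alpha] is linear in the base point. *)
Lemma derive_alpha z u v : 'D_u (fun q => alpha q v : R^o) z = alpha u v.
Proof.
rewrite /derive; apply: cvg_lim => //.
apply: (@cvg_trans _ ((fun=> alpha u v) @ (0 : R)^')); last exact: cvg_cst.
apply: near_eq_cvg; near=> h.
have h0 : h != 0 by near: h; exact: nbhs_dnbhs_neq.
rewrite /= alpha_linearl addrK /GRing.scale /=.
by rewrite mulKf.
Unshelve. all: by end_near. Qed.

Lemma alternating_dalpha z : alternating 2 (dalpha z).
Proof.
apply: alternating_form2 => [u|k u v w|k u v w]; rewrite !derive_alpha.
- by rewrite subrr.
- by rewrite alpha_linearl alpha_linearr; ring.
- by rewrite alpha_linearl alpha_linearr; ring.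
Qed.

Lemma alternating_contact_volume m z :
  alternating (1 + m * 2) (contact_volume m z).
Proof.
apply: alternating_wedge.
  by apply: alternating_form1 => k u v; exact: alpha_linearr.
exact/alternating_wedge_power/alternating_dalpha.
Qed.

Lemma rhoE z : rho z = \sum_j (z 0 j) ^+ 2.
Proof. by rewrite /rho big_split big_split_ord. Qed.

Lemma sphere_norm_le (r : R) z : 0 <= r -> sphere r z -> `|z| <= r.
Proof.
move=> r0; rewrite /sphere /= rhoE => zr; apply: row_norm_le => // j.
rewrite -(@ler_pXn2r _ 2) ?nnegrE // -normrX -zr ger0_norm ?sqr_ge0 //.
by rewrite (bigD1 j) //= lerDl sumr_ge0 // => i _; rewrite sqr_ge0.
Qed.

End ContactForm.

(** * The link *)

Section LinkMap.
Context {R : realType} {n k : nat}.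
Local Notation V := 'rV[R]_(n + n).
Implicit Types (F : V -> 'rV[R]_(k + k)) (z v : V).

(** The map [(F, rho - r ^ 2)], of which the link is the zero set. *)
Definition link_map F (r : R) z : 'rV[R]_(k + k + 1) :=
  row_mx (F z) (const_mx (rho z - r ^+ 2)).

Lemma link_map0 F r z : link F r z <-> link_map F r z = 0.
Proof.
rewrite /link_map; split=> [[]|].
  rewrite /zero_set /sphere /= => -> ->.
  by rewrite subrr -[RHS]row_mx0; congr row_mx; apply/rowP => j; rewrite !mxE.
move=> h; split; rewrite /zero_set /sphere /=.
  by have := congr1 lsubmx h; rewrite row_mxKl linear0.
have /rowP/(_ 0) := congr1 rsubmx h; rewrite row_mxKr linear0 !mxE.
by move/eqP; rewrite subr_eq0 => /eqP.
Qed.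

Lemma analytic_link_map F r z :
  real_analytic_at F z -> real_analytic_at (link_map F r) z.
Proof.
move=> hF; pose e : 'rV[R]_(k + k + 1) := row_mx 0 (const_mx 1).
have h1 := analytic_mulmx (row_mx 1%:M 0 : 'M[R]_(k + k, k + k + 1)) hF.
have h2 := analytic_sum (enum 'I_(n + n))
  (fun j => analytic_coordX j 2 e z).
have h3 := analytic_cst ((- r ^+ 2) *: e) z.
apply: near_eq_analytic (analyticD (analyticD h1 h2) h3).
near=> x; rewrite /link_map mul_mx_row mulmx1 mulmx0 big_enum /=.
rewrite -scaler_suml -rhoE -addrA -scalerDl /e scale_row_mx.
rewrite scaler0 add_row_mx addr0 add0r; congr row_mx.
by apply/rowP => j; rewrite !mxE mulr1.
Unshelve. all: by end_near. Qed.

Lemma diff_link_map F r z v : real_analytic_at F z ->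
  'd (link_map F r) z v = 0 ->
  [/\ 'd (rho : _ -> R^o) z v = 0,
      forall j, 'd (fun q => xcoord (F q) j : R^o) z v = 0
    & forall j, 'd (fun q => ycoord (F q) j : R^o) z v = 0].
Proof.
move=> hF dv0; have [dg _ _] := analytic_strict (analytic_link_map r hF).
have d0 i : 'd (fun q => link_map F r q 0 i : R^o) z v = 0.
  by have [_ ->] := diff_coord v i dg; rewrite dv0 mxE.
split.
- have -> : (rho : V -> R^o) =
      (fun q => link_map F r q 0 (rshift (k + k) 0) : R^o) + cst (r ^+ 2 : R^o).
    by apply/funext => q; rewrite !fctE /link_map row_mxEr mxE subrK.
  have [dc _] := diff_coord v (rshift (k + k) (0 : 'I_1)) dg.
  by rewrite diffD // diff_cst; apply: etrans (addr0 _) _; exact: d0.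
- move=> j; rewrite -(d0 (lshift 1 (lshift k j))); congr ('d _ z v).
  by apply/funext => q; rewrite /link_map row_mxEl.
- move=> j; rewrite -(d0 (lshift 1 (rshift k j))); congr ('d _ z v).
  by apply/funext => q; rewrite /link_map row_mxEl.
Qed.

Lemma alternating_diff (f : V -> R^o) z : alternating 1 (form1 ('d f z)).
Proof. by apply: alternating_form1 => c u v; rewrite linearP. Qed.

Lemma alternating_dF_wedge F z : alternating (k * 2) (dF_wedge F z).
Proof.
rewrite -[X in (X * _)%N](size_enum_ord k) enumT.
have -> : Finite.enum 'I_k = index_enum 'I_k by rewrite /index_enum; unlock.
apply: alternating_big_wedge => j.
by apply: (@alternating_wedge _ _ 1 1); apply: alternating_diff.
Qed.

(** [drho /\ w /\ dF] is a form of top degree. *)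
Lemma alternating_top F z w : (k < n)%N -> alternating ((n - k).*2.-1) w ->
  alternating (n + n) (wedge (drho z) (wedge w (dF_wedge F z))).
Proof.
move=> kn hw.
have e : (n + n = 1 + ((n - k).*2.-1 + k * 2))%N by lia.
rewrite [X in alternating X _]e; apply: alternating_wedge; first exact: alternating_diff.
by apply: alternating_wedge => //; exact: alternating_dF_wedge.
Qed.

Lemma alternating_cv z : (k < n)%N ->
  alternating ((n - k).*2.-1) (contact_volume (n - k - 1) z).
Proof.
move=> kn; have -> : ((n - k).*2.-1 = 1 + (n - k - 1) * 2)%N by lia.
exact: alternating_contact_volume.
Qed.

(** Each of the [2 k + 1] factors other than [w] needs an argument outside the
   kernel of the differential of [link_map]. *)
Lemma feeds_on_drho_dF F r z w p : real_analytic_at F z ->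
  let Q := fun v => v *m 'J (link_map F r) z != 0 in
  feeds_on Q p w ->
  feeds_on Q (k + k + 1 + p) (wedge (drho z) (wedge w (dF_wedge F z))).
Proof.
move=> hF Q hw.
have Qd v : ~~ Q v -> 'd (link_map F r) z v = 0.
  by rewrite negbK => /eqP; rewrite /jacobian mul_rV_lin1.
have -> : (k + k + 1 + p = 1 + (p + k * 2))%N by lia.
apply: feeds_on_wedge.
  by apply: feeds_on_form1 => v /Qd /(diff_link_map hF)[].
apply: feeds_on_wedge => //.
rewrite -[X in (X * _)%N](size_enum_ord k) enumT.
have -> : Finite.enum 'I_k = index_enum 'I_k by rewrite /index_enum; unlock.
apply: feeds_on_big => j; apply: (@feeds_on_wedge _ _ _ 1 1);
  apply: feeds_on_form1 => v /Qd /(diff_link_map hF)[_ h1 h2]; [exact: h1|exact: h2].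
Qed.

(** If the differential had rank at most [2 k], the [2 k + 1] factors [drho] and
   [df] could not all be fed by a basis adapted to its kernel. *)
Lemma link_map_regular F r z : (k < n)%N -> real_analytic_at F z ->
  wedge (drho z) (wedge (contact_volume (n - k - 1) z) (dF_wedge F z))
    complex_frame != 0 ->
  regular_point (link_map F r) z.
Proof.
move=> kn hF; apply: contraNeq => nr.
have rk : (\rank ('J (link_map F r) z) < k + k + 1 + 0)%N.
  by rewrite addn0 ltn_neqAle nr rank_leq_col.
apply/eqP; apply: (feeds_on_top0 _ _ rk).
  exact: alternating_top (alternating_cv z kn).
exact: feeds_on_drho_dF.
Qed.

(** [drho /\ w /\ dF] only depends on the restriction of [w] to the tangent
   space of the link: the difference [eta] of two choices of [w] needs an
   argument outside the kernel of the differential, since the kernel consists of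
   tangent vectors; so [drho /\ eta /\ dF] needs [2 k + 2] of them, one more than
   the rank. *)
Lemma top_form_tangent F r z (c : R) w : (k < n)%N -> real_analytic_at F z ->
  link F r z -> regular_point (link_map F r) z ->
  alternating ((n - k).*2.-1) w ->
  (forall s, (forall v, v \in s -> tangent (link F r) z v) ->
     w s = c * contact_volume (n - k - 1) z s) ->
  forall s, wedge (drho z) (wedge w (dF_wedge F z)) s =
    c * wedge (drho z) (wedge (contact_volume (n - k - 1) z) (dF_wedge F z)) s.
Proof.
move=> kn hF lz reg altw hw s; set cv := contact_volume _ _.
pose eta : ext_form V R := fun t => w t + (- c) * cv t.
have alteta : alternating ((n - k).*2.-1) eta.
  by apply: alternating_lin => //; exact: alternating_cv.
have tan v : v *m 'J (link_map F r) z = 0 -> tangent (link F r) z v.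
  move=> vJ.
  have [dg _ strict] := analytic_strict (analytic_link_map r hF).
  have dJ u : 'd (link_map F r) z u = u *m 'J (link_map F r) z.
    by rewrite /jacobian mul_rV_lin1.
  have strictJ e : 0 < e -> exists2 d, 0 < d & forall x y : V, `|x - z| < d ->
      `|y - z| < d -> `|link_map F r x - link_map F r y -
        (x - y) *m 'J (link_map F r) z| <= e * `|x - y|.
    by move=> /strict[d d0 hd]; exists d => // x y xd yd; rewrite -dJ; apply: hd.
  have g0 : link_map F r z = 0 by apply/link_map0.
  have [gamma [gz gl gd]] := kernel_velocity g0 strictJ reg vJ.
  by exists gamma; split=> //; apply: filterS gl => t ht; apply/link_map0.
have fe : feeds_on (fun v => v *m 'J (link_map F r) z != 0) 1 eta.
  move=> t; rewrite ltnS leqn0 => /eqP/eqP; rewrite -leqn0 leqNgt -has_count => /hasPn h.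
  rewrite /eta hw ?mulNr ?addrN // => v /h; rewrite negbK => /eqP; exact: tan.
have z0 : wedge (drho z) (wedge eta (dF_wedge F z)) s = 0.
  apply: (feeds_on_top0 (alternating_top F z kn alteta) (feeds_on_drho_dF hF fe)).
  by rewrite reg [X in (_ < X)%N]addn1.
have : wedge (drho z) (wedge eta (dF_wedge F z)) s =
   wedge (drho z) (wedge w (dF_wedge F z)) s +
   (- c) * wedge (drho z) (wedge cv (dF_wedge F z)) s.
  rewrite -wedgeZr -wedgeDr; apply: eq_wedge => // t.
  by rewrite -wedgeZl -wedgeDl.
by rewrite z0 mulNr => /esym/eqP; rewrite subr_eq0 => /eqP.
Qed.

(** The constant is positive because ['i ^+ n * (- (2 * 'i)) ^+ n = 2 ^+ n]. *)
Lemma DF_frame F z : DF F z != 0 ->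
  wedge (drho z) (wedge (contact_volume (n - k - 1) z) (dF_wedge F z))
    complex_frame = 2 ^+ n * 2 ^+ (n - k - 1) * (n - k - 1)`!%:R * DF F z.
Proof.
rewrite /DF; case: xgetP => [D -> hD _|_]; last by rewrite eqxx.
have := hD complex_frame; rewrite dz_dzbar_frame.
set T := wedge _ _ _; set m := (n - k - 1)%N.
have i2 : 'i ^+ n * (- (2 * 'i)) ^+ n = (2 ^+ n)%:C%C :> R[i].
  rewrite -exprMn rmorphXn /=; congr (_ ^+ _).
  by apply/eqP; rewrite eq_complex /=; apply/andP; split; apply/eqP; ring.
move=> hT; apply: (@complexI R); rewrite hT !rmorphM /= -i2 !rmorphXn /= !rmorph_nat.
ring.
Qed.

End LinkMap.

Section Links.
Context {R : realType} {n k : nat}.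
Variable (F : 'rV[R]_(n + n) -> 'rV[R]_(k + k)).

(** The common part of the two cases, which are [c = 1] and [c = -1]. *)
Lemma contact_links (c : R) : (k < n)%N -> mixed_ICIS F ->
  (\forall z \near (0 : 'rV[R]_(n + n)), zero_set F z -> z != 0 -> 0 < c * DF F z) ->
  \forall r \near (0 : R)^'+,
  [/\ submanifold ((n - k).*2.-1) (link F r), link F r `<=` sphere r
    & forall z, link F r z -> positive_on_link F r z
        (fun s => c * contact_volume (n - k - 1) z s)].
Proof.
move=> kn [[F0 aF] _ _ _] hD.
have /nbhs_ballP[d /= d0 hd] : \forall z \near (0 : 'rV[R]_(n + n)),
    real_analytic_at F z /\ (zero_set F z -> z != 0 -> 0 < c * DF F z).
  by apply: filterI.
have key r z : 0 < r < d -> link F r z ->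
    [/\ ball 0 d z, real_analytic_at F z & 0 < c * DF F z].
  move=> /andP[r0 rd] [Fz sz].
  have zd : ball 0 d z.
    rewrite -ball_normE /= sub0r normrN; apply: le_lt_trans rd.
    by apply: sphere_norm_le sz; exact: ltW.
  have [az hz] := hd _ zd; split=> //; apply: hz => //.
  apply: contraTneq r0 => z0; move: sz; rewrite /sphere /= z0 rhoE big1.
    by move=> /esym/eqP; rewrite sqrf_eq0 => /eqP ->; rewrite ltxx.
  by move=> j _; rewrite mxE expr0n.
near=> r.
have rd : 0 < r < d by apply/andP; split; near: r; [exact: nbhs_right_gt|exact: nbhs_right_lt].
have frame z : link F r z -> 0 < c * wedge (drho z)
    (wedge (contact_volume (n - k - 1) z) (dF_wedge F z)) complex_frame.
  move=> lz; have [_ _ cD] := key r z rd lz.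
  have D0 : DF F z != 0 by apply: contraTneq cD => ->; rewrite mulr0 ltxx.
  by rewrite DF_frame // mulrCA mulr_gt0 // !mulr_gt0 ?exprn_gt0 //.
have reg z : link F r z -> regular_point (link_map F r) z.
  move=> lz; have [_ az _] := key r z rd lz; apply: link_map_regular => //.
  by apply: contraTneq (frame z lz) => ->; rewrite mulr0 ltxx.
split.
- move=> z lz; have [zd _ _] := key r z rd lz.
  exists (ball 0 d), (k + k + 1)%N, (link_map F r); split.
  + by split=> //; exact: ball_open.
  + lia.
  + by apply: analytic_smooth => x xd; apply: analytic_link_map; have [] := hd x xd.
  + by move=> x _; exact: link_map0.
  + by move=> x _; exact: reg.
- by move=> z [].
- move=> z lz w altw hw; rewrite /positive_complex_orientation.
  have [_ az _] := key r z rd lz.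
  by rewrite (top_form_tangent kn az lz (reg z lz) altw hw); exact: frame.
Unshelve. all: by end_near. Qed.
End Links.

Theorem theorem3p8 (R : realType) (n k : nat) (hk : (1 <= k)%N) (hkn : (k < n)%N)
    (F : 'rV[R]_(n + n) -> 'rV[R]_(k + k)) :
  (strictly_holomorphic_like F ->
     \forall r \near (0 : R)^'+, positive_contact_submanifold F r) /\
  (strictly_antiholomorphic_like F ->
     \forall r \near (0 : R)^'+, negative_contact_submanifold F r).
Proof.
split=> [[icis hD]|[icis hD]].
  have pos : \forall z \near (0 : 'rV[R]_(n + n)),
      zero_set F z -> z != 0 -> 0 < 1 * DF F z.
    by apply: filterS hD => z h Fz z0; rewrite mul1r; apply: h.
  apply: filterS (contact_links hkn icis pos) => r [h1 h2 h3]; split=> // z lz w' aw hw.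
  by apply: (h3 z lz w' aw) => s /hw ->; rewrite mul1r.
have neg : \forall z \near (0 : 'rV[R]_(n + n)),
    zero_set F z -> z != 0 -> 0 < (- 1) * DF F z.
  by apply: filterS hD => z h Fz z0; rewrite mulN1r oppr_gt0; apply: h.
apply: filterS (contact_links hkn icis neg) => r [h1 h2 h3]; split=> // z lz w' aw hw.
by apply: (h3 z lz w' aw) => s /hw ->; rewrite mulN1r.
Qed.
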